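(* Let $L$ be an uncountable compact line and let $K=L^\omega$ be endowed with the lexicographic order. Then there exist a compact line $\widetilde K$ and a continuous increasing surjection $\phi:\widetilde K\to K$ that has the $c_0$-extension property but does not have the $c_0(\omega_1)$-extension property.
   Context: A compact line is a totally ordered set which is compact in its order topology. For a set $I$, $c_0(I)$ is the Banach space (sup norm) of real families $(a_i)_{i\in I}$ with $\{i:|a_i|\ge\varepsilon\}$ finite for all $\varepsilon>0$. A continuous surjection $\phi:\widetilde K\to K$ has the $c_0(I)$-extension property if every bounded linear operator from the closed subspace $\{f\circ\phi:f\in C(K)\}$ of $C(\widetilde K)$ into $c_0(I)$ admits a bounded linear extension to $C(\widetilde K)$; the $c_0$-extension property is the case $I=\mathbb N$. *)

(* Defs.v *)
From Stdlib Require Import Reals List.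
Open Scope R_scope.

Section Lines.
Variable T : Type.
Variable le : T -> T -> Prop.

Definition total_order : Prop :=
  (forall x, le x x) /\
  (forall x y, le x y -> le y x -> x = y) /\
  (forall x y z, le x y -> le y z -> le x z) /\
  (forall x y, le x y \/ le y x).

Definition lt (x y : T) : Prop := le x y /\ x <> y.

(* the open "interval" with optional endpoints (None = unbounded side);
   these are exactly the finite intersections of open rays
   {y | a < y} and {y | y < b} *)
Definition oint (lo hi : option T) (y : T) : Prop :=
  match lo with Some a => lt a y | None => True end /\
  match hi with Some b => lt y b | None => True end.

Definition order_open (U : T -> Prop) : Prop :=
  forall x, U x -> exists lo hi, oint lo hi x /\ (forall y, oint lo hi y -> U y).

Definition order_compact : Prop :=
  forall (I : Type) (U : I -> T -> Prop),
    (forall i, order_open (U i)) -> (forall x, exists i, U i x) ->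
    exists s : list I, forall x, exists i, In i s /\ U i x.

Definition compact_line : Prop := total_order /\ order_compact.

Definition cont_real (f : T -> R) : Prop :=
  forall V : R -> Prop, open_set V -> order_open (fun x => V (f x)).

End Lines.

Arguments total_order {T}.
Arguments lt {T}.
Arguments oint {T}.
Arguments order_open {T}.
Arguments order_compact {T}.
Arguments compact_line {T}.
Arguments cont_real {T}.

Definition countable (T : Type) : Prop :=
  exists f : T -> nat, forall x y, f x = f y -> x = y.

Definition uncountable (T : Type) : Prop := ~ countable T.

Definition countable_set {T : Type} (A : T -> Prop) : Prop :=
  exists f : T -> nat, forall x y, A x -> A y -> f x = f y -> x = y.

(* (I, ltI) is (order-isomorphic to) the first uncountable ordinal omega_1:
   a strict well-order, uncountable, all of whose proper initial segments
   are countable.  Only the cardinality of I matters below. *)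
Definition is_omega1 {I : Type} (ltI : I -> I -> Prop) : Prop :=
  well_founded ltI /\
  (forall i j k, ltI i j -> ltI j k -> ltI i k) /\
  (forall i j, ltI i j \/ i = j \/ ltI j i) /\
  uncountable I /\
  (forall i, countable_set (fun j => ltI j i)).

Definition lex {L : Type} (le : L -> L -> Prop) (s t : nat -> L) : Prop :=
  (forall n, s n = t n) \/
  exists n, (forall m, (m < n)%nat -> s m = t m) /\ lt le (s n) (t n).

Definition order_continuous {X Y : Type} (leX : X -> X -> Prop)
  (leY : Y -> Y -> Prop) (phi : X -> Y) : Prop :=
  forall U, order_open leY U -> order_open leX (fun x => U (phi x)).

Definition order_increasing {X Y : Type} (leX : X -> X -> Prop)
  (leY : Y -> Y -> Prop) (phi : X -> Y) : Prop :=
  forall x y, leX x y -> leY (phi x) (phi y).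

Definition onto {X Y : Type} (phi : X -> Y) : Prop :=
  forall y, exists x, phi x = y.

Definition in_c0 {I : Type} (a : I -> R) : Prop :=
  forall eps, 0 < eps -> exists s : list I, forall i, eps <= Rabs (a i) -> In i s.

Definition bdd_lin_op_c0 {X I : Type} (D : (X -> R) -> Prop)
  (T : (X -> R) -> (I -> R)) : Prop :=
  (forall g h a b, D g -> D h ->
     forall i, T (fun x => a * g x + b * h x) i = a * T g i + b * T h i) /\
  (exists M, forall g, D g -> (forall x, Rabs (g x) <= 1) ->
     forall i, Rabs (T g i) <= M) /\
  (forall g, D g -> in_c0 (T g)).

Definition c0I_ext_property {Kt K : Type} (leKt : Kt -> Kt -> Prop)
  (leK : K -> K -> Prop) (phi : Kt -> K) (I : Type) : Prop :=
  let CKt := cont_real leKt in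
  let V := fun g : Kt -> R =>
    exists f : K -> R, cont_real leK f /\ forall x, g x = f (phi x) in
  forall T : (Kt -> R) -> (I -> R),
    bdd_lin_op_c0 V T ->
    exists E : (Kt -> R) -> (I -> R),
      bdd_lin_op_c0 CKt E /\ forall g, V g -> forall i, E g i = T g i.

(* Main.v *)
Require Import Defs.
From Stdlib Require Import Reals List Lra Lia Cantor Wellfounded ClassicalEpsilon.
From Stdlib Require Import FunctionalExtensionality PropExtensionality ProofIrrelevance.
From Coquelicot Require Import Rcomplements Hierarchy Series.
From mathcomp Require boolp classical_sets wochoice.

(** Let [Z] be a copy of omega_1 inside [L].  Every nonzero [a] in [Z] has a
    countable set of predecessors; enumerating it gives a point [t a] of [L^omega].
    The line [Kt] is [K = L^omega] with every [t a] split in two, so that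
    [C(Kt)] is spanned by the pullbacks of [C(K)] and the indicators [cut a] of
    the initial segments ending in the gap at [t a].  A node is the interval of
    all points of [K] with a given finite initial word, and [cut a] differs from
    a continuous function on [K] only by a function supported in any prescribed
    node around [t a].

    A sequence of functionals on [C(K)], extended to [C(Kt)] by Hahn-Banach,
    charges countably many nodes.  All letters of these are bounded in [Z], hence
    all but countably many [t a] lie in a node that is not charged, and there the
    extended functionals converge to zero by themselves.  The countably many
    remaining points are dealt with as in Sobczyk's theorem.

    Conversely, evaluating the difference between the endpoints of the nodes
    [t a|n] gives an operator from [C(K)] to [c_0(omega_1)].  For an extension
    [E] and every [a] there is [n a] such that [E (cut a)] is small at all nodes
    of length at least [n a].  By a closing-off argument some node of length [n]
    contains infinitely many [t a] with [n a = n]; the functional at that node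
    would be large on infinitely many disjoint bumps. *)

(** * Compact and complete lines *)

(** Two opposing demands shape the points [t a]. For the first property a countable subfamily must
    account for few of them: only countably many [a] may draw every letter [t a k] from the letters
    at position [k] in the subfamily. For the second, initial words must repeat: whatever length
    [n a] is assigned to each [a], one node must contain uncountably many [t a] whose assigned
    length is its own. Enumerations of predecessors meet both, because the whole sequence determines
    its ordinal, while a finite word names only finitely many smaller ones. Both halves rest on one
    estimate, which stands in for the total variation of a measure: on functions bounded by 1 with
    disjoint supports, a functional bounded by [M] takes values whose absolute values sum to at most
    [M]. The functions fed to it in the end are [cut a] minus a function on [K] that falls from 1 to
    0 across a node. They can be supported in arbitrarily small nodes, so finitely many of them can
    always be made disjoint. *)

Lemma le_lt_cases {X} {le : X -> X -> Prop} (Hle : total_order le) x y :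
  le x y \/ lt le y x.
Proof.
  destruct Hle as (Hr & _ & _ & Ht).
  destruct (classic (x = y)) as [->|Hne]; [left; apply Hr|].
  destruct (Ht x y) as [H|H]; [left; exact H|].
  right; split; [exact H|]; congruence.
Qed.

Lemma lt_not_le {X} {le : X -> X -> Prop} (Hle : total_order le) x y :
  lt le x y -> ~ le y x.
Proof. destruct Hle as (_ & Ha & _ & _). intros [H1 H2] H3. apply H2, Ha; assumption. Qed.

Lemma le_lt_trans {X} {le : X -> X -> Prop} (Hle : total_order le) x y z :
  le x y -> lt le y z -> lt le x z.
Proof.
  intros H1 H2. destruct (le_lt_cases Hle z x) as [H|H]; [|exact H].
  exfalso. apply (lt_not_le Hle _ _ H2). destruct Hle as (_ & _ & Ht & _). eauto.
Qed.

Lemma lt_le_trans {X} {le : X -> X -> Prop} (Hle : total_order le) x y z :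
  lt le x y -> le y z -> lt le x z.
Proof.
  intros H1 H2. destruct (le_lt_cases Hle z x) as [H|H]; [|exact H].
  exfalso. apply (lt_not_le Hle _ _ H1). destruct Hle as (_ & _ & Ht & _). eauto.
Qed.

Definition upper_bound {X} (le : X -> X -> Prop) (A : X -> Prop) u :=
  forall x, A x -> le x u.

Definition least_upper_bound {X} (le : X -> X -> Prop) (A : X -> Prop) s :=
  upper_bound le A s /\ forall u, upper_bound le A u -> le s u.

Definition complete_line {X} (le : X -> X -> Prop) :=
  total_order le /\ forall A, exists s, least_upper_bound le A s.

Lemma list_has_max {X} {le : X -> X -> Prop} (Hle : total_order le) (P : X -> Prop) l :
  (forall x, In x l -> ~ P x) \/
  exists m, In m l /\ P m /\ forall x, In x l -> P x -> le x m.
Proof.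
  destruct Hle as (Hr & Ha & Ht & Hto).
  induction l as [|a l IH]; [left; intros x []|].
  destruct (classic (P a)) as [Pa|Pa].
  - right. destruct IH as [IH|(m & Hm & Pm & IH)].
    + exists a; split; [left; reflexivity|split; [exact Pa|]].
      intros x [<-|Hx] Px; [apply Hr|exfalso; exact (IH x Hx Px)].
    + destruct (Hto a m) as [Ham|Hma].
      * exists m; split; [right; exact Hm|split; [exact Pm|]].
        intros x [<-|Hx] Px; auto.
      * exists a; split; [left; reflexivity|split; [exact Pa|]].
        intros x [<-|Hx] Px; eauto.
  - destruct IH as [IH|(m & Hm & Pm & IH)].
    + left. intros x [<-|Hx]; auto.
    + right. exists m; split; [right; exact Hm|split; [exact Pm|]].
      intros x [<-|Hx] Px; [contradiction|auto].
Qed.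

Lemma flip_order {X} {le : X -> X -> Prop} (Hle : total_order le) :
  total_order (fun x y => le y x).
Proof. destruct Hle as (Hr & Ha & Ht & Hto). repeat split; eauto. Qed.

Lemma order_open_right {X} {le : X -> X -> Prop} a : order_open le (fun y => lt le a y).
Proof.
  intros x Hx. exists (Some a), None. split; [split; [exact Hx|exact I]|].
  intros y [Hy _]; exact Hy.
Qed.

Lemma order_open_left {X} {le : X -> X -> Prop} a : order_open le (fun y => lt le y a).
Proof.
  intros x Hx. exists None, (Some a). split; [split; [exact I|exact Hx]|].
  intros y [_ Hy]; exact Hy.
Qed.

(* If [A] had no supremum, the rays below the elements of [A] and above its
   upper bounds would form an open cover without finite subcover. *)
Lemma compact_line_complete {X} {le : X -> X -> Prop} (x0 : X) :
  compact_line le -> complete_line le.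
Proof.
  intros [Hle Hc]; split; [exact Hle|]. intros A. apply NNPP; intros Hno.
  destruct (Hc X (fun i y => (A i /\ lt le y i) \/ (upper_bound le A i /\ lt le i y)))
    as [s Hs].
  - intros i x [[Ai Hx]|[Ui Hx]].
    + destruct (order_open_left i x Hx) as (lo & hi & H1 & H2).
      exists lo, hi; split; [exact H1|]. intros y Hy; left; split; auto.
    + destruct (order_open_right i x Hx) as (lo & hi & H1 & H2).
      exists lo, hi; split; [exact H1|]. intros y Hy; right; split; auto.
  - intros x. destruct (classic (upper_bound le A x)) as [Hu|Hu].
    + apply NNPP; intros Hn. apply Hno. exists x; split; [exact Hu|].
      intros u Hu'. destruct (le_lt_cases Hle x u) as [H|H]; [exact H|].
      exfalso; apply Hn. exists u; right; split; assumption.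
    + apply not_all_ex_not in Hu. destruct Hu as [a Ha].
      apply imply_to_and in Ha. destruct Ha as [Ha Hax].
      exists a; left; split; [exact Ha|].
      destruct (le_lt_cases Hle a x) as [H|H]; [contradiction|exact H].
  - assert (irr : forall x, ~ lt le x x) by (intros x [_ H]; congruence).
    destruct (list_has_max Hle A s) as [HA|(m & Hm & Am & HA)].
    + destruct (list_has_max (flip_order Hle) (upper_bound le A) s) as [HU|(u & Hu & Uu & HU)].
      * destruct (Hs x0) as (i & Hi & [[H _]|[H _]]); [exact (HA i Hi H)|exact (HU i Hi H)].
      * destruct (Hs u) as (i & Hi & [[H _]|[H Hlt]]); [exact (HA i Hi H)|].
        exact (lt_not_le Hle _ _ Hlt (HU i Hi H)).
    + destruct (Hs m) as (i & Hi & [[H Hlt]|[H Hlt]]).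
      * exact (lt_not_le Hle _ _ Hlt (HA i Hi H)).
      * exact (lt_not_le Hle _ _ Hlt (H m Am)).
Qed.

Lemma complete_bottom {X} {le : X -> X -> Prop} :
  complete_line le -> exists b, forall x, le b x.
Proof.
  intros [_ Hc]. destruct (Hc (fun _ => False)) as [b [_ Hb]].
  exists b. intros x. apply Hb. intros y [].
Qed.

Lemma complete_top {X} {le : X -> X -> Prop} :
  complete_line le -> exists b, forall x, le x b.
Proof.
  intros [_ Hc]. destruct (Hc (fun _ => True)) as [b [Hb _]].
  exists b. intros x. apply Hb. exact I.
Qed.

Definition adjacent {X} (le : X -> X -> Prop) p q :=
  lt le p q /\ forall z, le z p \/ le q z.

(** Real induction on a line. The supremum [c] of [P] satisfies [P], since otherwise a point of [P]
    inside the neighbourhood of [c] would be one good step below it. It is the top, since otherwise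
    a point of that neighbourhood above [c], or failing this its right end, which is then adjacent
    to [c], would again satisfy [P]. *)
Lemma complete_line_induction {X} {le : X -> X -> Prop} (P : X -> Prop)
  (good : X -> X -> Prop) :
  complete_line le ->
  (forall b, (forall x, le b x) -> P b) ->
  (forall x y, P x -> lt le x y -> good x y -> P y) ->
  (forall c, exists lo hi, oint le lo hi c /\
     forall x y, oint le lo hi x -> oint le lo hi y -> lt le x y -> good x y) ->
  (forall x y, adjacent le x y -> good x y) ->
  exists z, P z /\ forall x, le x z.
Proof.
  intros [Hle Hc] Hbot Hstep Hloc Hadj.
  destruct (complete_bottom (conj Hle Hc)) as [b Hb].
  destruct (Hc P) as [c [Hub Hlub]].
  destruct (Hloc c) as (lo & hi & Hcin & Hgood).
  assert (Pc : P c).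
  { apply NNPP; intros NPc.
    assert (exists x, P x /\ oint le lo hi x /\ lt le x c) as (x & Px & Hx & Hxc).
    { destruct lo as [a|].
      - destruct Hcin as [Hac Hchi].
        assert (~ upper_bound le P a) as Hn.
        { intros H. exact (lt_not_le Hle _ _ Hac (Hlub a H)). }
        apply not_all_ex_not in Hn. destruct Hn as [x Hx].
        apply imply_to_and in Hx. destruct Hx as [Px Hxa].
        exists x. assert (lt le x c) as Hxc.
        { split; [apply Hub, Px|]. intros ->; contradiction. }
        split; [exact Px|split; [|exact Hxc]]. split.
        + destruct (le_lt_cases Hle x a) as [H|H]; [contradiction|exact H].
        + destruct hi as [h|]; [|exact I].
          apply (le_lt_trans Hle _ c); [apply Hxc|exact Hchi].
      - exists b. assert (lt le b c) as Hbc.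
        { split; [apply Hb|]. intros <-. apply NPc, Hbot, Hb. }
        split; [apply Hbot, Hb|split; [|exact Hbc]]. split; [exact I|].
        destruct hi as [h|]; [|exact I]. destruct Hcin as [_ Hchi].
        apply (le_lt_trans Hle _ c); [apply Hbc|exact Hchi]. }
    apply NPc, (Hstep x c Px Hxc), Hgood; assumption. }
  exists c; split; [exact Pc|]. intros x.
  destruct (le_lt_cases Hle x c) as [H|Hcx]; [exact H|exfalso].
  assert (Hmax : forall y, lt le c y -> ~ P y).
  { intros y Hy Py. exact (lt_not_le Hle _ _ Hy (Hub y Py)). }
  destruct (classic (exists y, lt le c y /\ oint le lo hi y)) as [(y & Hcy & Hy)|Hn].
  - apply (Hmax y Hcy), (Hstep c y Pc Hcy), Hgood; assumption.
  - destruct Hcin as [Hloc' Hchi].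
    assert (Hlo : forall y, lt le c y -> match lo with Some a => lt le a y | None => True end).
    { intros y Hy. destruct lo as [a|]; [|exact I].
      apply (lt_le_trans Hle _ c); [exact Hloc'|apply Hy]. }
    destruct hi as [h|].
    + apply (Hmax h Hchi), (Hstep c h Pc Hchi), Hadj. split; [exact Hchi|].
      intros z. destruct (le_lt_cases Hle z c) as [H|H]; [left; exact H|].
      destruct (le_lt_cases Hle h z) as [H'|H']; [right; exact H'|].
      exfalso; apply Hn; exists z. split; [exact H|split; [apply Hlo, H|exact H']].
    + apply Hn; exists x; split; [exact Hcx|split; [apply Hlo, Hcx|exact I]].
Qed.

Lemma complete_line_compact {X} {le : X -> X -> Prop} :
  complete_line le -> compact_line le.
Proof.
  intros Hcl. split; [apply Hcl|]. intros I U HU Hcov.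
  pose proof (proj1 Hcl) as Hle. pose proof Hle as (Hr & Ha & Ht & _).
  destruct (complete_line_induction
    (fun x => exists s : list I, forall y, le y x -> exists i, In i s /\ U i y)
    (fun x y => exists s : list I, forall z, le x z -> le z y -> exists i, In i s /\ U i z) Hcl)
    as (z & [s Hs] & Hz).
  - intros b Hb. destruct (Hcov b) as [i Hi]. exists (i :: nil).
    intros y Hy. exists i; split; [left; reflexivity|].
    rewrite (Ha y b Hy (Hb y)); exact Hi.
  - intros x y [s Hs] _ [s' Hs']. exists (s ++ s'). intros z Hz.
    destruct (proj2 (proj2 (proj2 Hle)) z x) as [H|H].
    + destruct (Hs z H) as (i & Hi & Ui). exists i; split; [apply in_or_app; left; exact Hi|exact Ui].
    + destruct (Hs' z H Hz) as (i & Hi & Ui). exists i; split; [apply in_or_app; right; exact Hi|exact Ui].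
  - intros c. destruct (Hcov c) as [i Hi]. destruct (HU i c Hi) as (lo & hi & Hc & Hin).
    exists lo, hi; split; [exact Hc|]. intros x y [Hx _] [_ Hy] _. exists (i :: nil).
    intros z Hxz Hzy. exists i; split; [left; reflexivity|]. apply Hin. split.
    + destruct lo; [|exact Logic.I]. eapply (lt_le_trans Hle); eauto.
    + destruct hi; [|exact Logic.I]. eapply (le_lt_trans Hle); eauto.
  - intros x y [_ Hxy]. destruct (Hcov x) as [i Hi]. destruct (Hcov y) as [j Hj].
    exists (i :: j :: nil). intros z Hxz Hzy. destruct (Hxy z) as [H|H].
    + exists i; split; [left; reflexivity|]. rewrite (Ha z x H Hxz); exact Hi.
    + exists j; split; [right; left; reflexivity|]. rewrite (Ha z y Hzy H); exact Hj.
  - exists s. intros x. apply Hs, Hz.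
Qed.

Lemma oint_inter {X} {le : X -> X -> Prop} (Hle : total_order le) lo hi lo' hi' c :
  oint le lo hi c -> oint le lo' hi' c ->
  exists l h, oint le l h c /\
    forall x, oint le l h x -> oint le lo hi x /\ oint le lo' hi' x.
Proof.
  intros [H1 H2] [H3 H4].
  assert (exists l, match l with Some a => lt le a c | None => True end /\
    forall x, match l with Some a => lt le a x | None => True end ->
      match lo with Some a => lt le a x | None => True end /\
      match lo' with Some a => lt le a x | None => True end) as (l & Hl & Hl').
  { destruct lo as [a|]; [|exists lo'; tauto].
    destruct lo' as [a'|]; [|exists (Some a); tauto].
    destruct (proj2 (proj2 (proj2 Hle)) a a') as [H|H].
    - exists (Some a'); split; [exact H3|]. intros x Hx; split; [|exact Hx].
      eapply le_lt_trans; eauto.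
    - exists (Some a); split; [exact H1|]. intros x Hx; split; [exact Hx|].
      eapply le_lt_trans; eauto. }
  assert (exists h, match h with Some a => lt le c a | None => True end /\
    forall x, match h with Some a => lt le x a | None => True end ->
      match hi with Some a => lt le x a | None => True end /\
      match hi' with Some a => lt le x a | None => True end) as (h & Hh & Hh').
  { destruct hi as [a|]; [|exists hi'; tauto].
    destruct hi' as [a'|]; [|exists (Some a); tauto].
    destruct (proj2 (proj2 (proj2 Hle)) a a') as [H|H].
    - exists (Some a); split; [exact H2|]. intros x Hx; split; [exact Hx|].
      eapply lt_le_trans; eauto.
    - exists (Some a'); split; [exact H4|]. intros x Hx; split; [|exact Hx].
      eapply lt_le_trans; eauto. }
  exists l, h; split; [split; assumption|].
  intros x [Hx1 Hx2]. apply Hl' in Hx1. apply Hh' in Hx2. unfold oint. tauto.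
Qed.

(** * Continuous real functions on a line *)

Lemma cont_real_iff {X} {le : X -> X -> Prop} (f : X -> R) :
  cont_real le f <->
  forall x eps, 0 < eps -> exists lo hi, oint le lo hi x /\
    forall y, oint le lo hi y -> Rabs (f y - f x) < eps.
Proof.
  split.
  - intros Hf x eps Heps.
    apply (Hf (disc (f x) (mkposreal eps Heps)) (disc_P1 _ _) x).
    unfold disc; simpl. rewrite Rminus_diag, Rabs_R0. exact Heps.
  - intros Hf V HV x Hx. destruct (HV (f x) Hx) as [[d Hd] Hin].
    destruct (Hf x d Hd) as (lo & hi & H1 & H2).
    exists lo, hi; split; [exact H1|]. intros y Hy. apply Hin. exact (H2 y Hy).
Qed.

Lemma cont_real_const {X} {le : X -> X -> Prop} c : cont_real le (fun _ => c).
Proof.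
  apply cont_real_iff. intros x eps Heps. exists None, None.
  split; [split; exact I|]. intros. rewrite Rminus_diag, Rabs_R0. exact Heps.
Qed.

Lemma small_multiple eps a : 0 < eps -> exists d, 0 < d /\ Rabs a * d < eps / 2.
Proof.
  intros Heps. pose proof (Rabs_pos a).
  assert (0 < eps / (2 * (1 + Rabs a))) by (apply Rdiv_lt_0_compat; lra).
  exists (eps / (2 * (1 + Rabs a))). split; [assumption|].
  replace (Rabs a * (eps / (2 * (1 + Rabs a)))) with
    (eps / 2 - eps / (2 * (1 + Rabs a))) by (field; lra). lra.
Qed.

Lemma cont_real_lin {X} {le : X -> X -> Prop} (Hle : total_order le) f g a b :
  cont_real le f -> cont_real le g -> cont_real le (fun x => a * f x + b * g x).
Proof.
  rewrite !cont_real_iff. intros Hf Hg x eps Heps.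
  destruct (small_multiple eps a Heps) as (da & Hda & Ha).
  destruct (small_multiple eps b Heps) as (db & Hdb & Hb).
  destruct (Hf x da Hda) as (lo & hi & H1 & H2).
  destruct (Hg x db Hdb) as (lo' & hi' & H3 & H4).
  destruct (oint_inter Hle _ _ _ _ _ H1 H3) as (l & h & H5 & H6).
  exists l, h; split; [exact H5|]. intros y Hy. destruct (H6 y Hy) as [Hy1 Hy2].
  specialize (H2 y Hy1). specialize (H4 y Hy2).
  replace (a * f y + b * g y - (a * f x + b * g x))
    with (a * (f y - f x) + b * (g y - g x)) by ring.
  eapply Rle_lt_trans; [apply Rabs_triang|]. rewrite !Rabs_mult.
  pose proof (Rmult_le_compat_l _ _ _ (Rabs_pos a) (Rlt_le _ _ H2)).
  pose proof (Rmult_le_compat_l _ _ _ (Rabs_pos b) (Rlt_le _ _ H4)). lra.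
Qed.

Definition bounded_fun {X} (f : X -> R) := exists c, forall x, Rabs (f x) <= c.

Lemma cont_real_bounded {X} {le : X -> X -> Prop} (f : X -> R) :
  compact_line le -> cont_real le f -> bounded_fun f.
Proof.
  intros [Hle Hc] Hf. pose proof (proj1 (cont_real_iff f) Hf) as Hf'.
  destruct (Hc X (fun i y => exists lo hi, oint le lo hi i /\ oint le lo hi y /\
    forall z, oint le lo hi z -> Rabs (f z - f i) < 1)) as [s Hs].
  - intros i x (lo & hi & H1 & H2 & H3). exists lo, hi; split; [exact H2|].
    intros y Hy. exists lo, hi; auto.
  - intros x. destruct (Hf' x 1 Rlt_0_1) as (lo & hi & H1 & H2). exists x, lo, hi; auto.
  - assert (exists c, forall i, In i s -> Rabs (f i) <= c) as [c Hcs].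
    { clear Hs. induction s as [|a s [c IH]]; [exists 0; intros i []|].
      exists (Rmax (Rabs (f a)) c). intros i [<-|Hi]; [apply Rmax_l|].
      eapply Rle_trans; [apply IH, Hi|apply Rmax_r]. }
    exists (c + 1). intros x. destruct (Hs x) as (i & Hi & lo & hi & _ & H2 & H3).
    specialize (H3 x H2). specialize (Hcs i Hi).
    pose proof (Rabs_triang (f x - f i) (f i)) as H.
    replace (f x - f i + f i) with (f x) in H by ring. lra.
Qed.

Definition step_le {X} (le : X -> X -> Prop) p (x : X) : R :=
  if excluded_middle_informative (le x p) then 1 else 0.

Lemma step_le_1 {X} (le : X -> X -> Prop) p x : le x p -> step_le le p x = 1.
Proof. unfold step_le. destruct excluded_middle_informative; [reflexivity|contradiction]. Qed.

Lemma step_le_0 {X} (le : X -> X -> Prop) p x : ~ le x p -> step_le le p x = 0.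
Proof. unfold step_le. destruct excluded_middle_informative; [contradiction|reflexivity]. Qed.

Lemma step_le_range {X} (le : X -> X -> Prop) p x : 0 <= step_le le p x <= 1.
Proof. unfold step_le. destruct excluded_middle_informative; lra. Qed.

(** On either side of the gap the indicator is constant on an open ray: the points below [q] are
    those up to [p], and the points above [p] are those from [q] on. *)
Lemma cont_step_le {X} {le : X -> X -> Prop} p q :
  total_order le -> adjacent le p q -> cont_real le (step_le le p).
Proof.
  intros Hle [Hpq Hadj]. apply cont_real_iff. intros x eps Heps.
  destruct (Hadj x) as [H|H].
  - exists None, (Some q). split; [split; [exact I|exact (le_lt_trans Hle _ _ _ H Hpq)]|].
    intros y [_ Hy]. rewrite (step_le_1 _ _ x H), step_le_1.
    + rewrite Rminus_diag, Rabs_R0; exact Heps.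
    + destruct (Hadj y) as [H'|H']; [exact H'|].
      exfalso; exact (lt_not_le Hle _ _ Hy H').
  - exists (Some p), None. split; [split; [exact (lt_le_trans Hle _ _ _ Hpq H)|exact I]|].
    intros y [Hy _]. rewrite (step_le_0 _ _ x), (step_le_0 _ _ y).
    + rewrite Rminus_diag, Rabs_R0; exact Heps.
    + exact (lt_not_le Hle _ _ Hy).
    + exact (lt_not_le Hle _ _ (lt_le_trans Hle _ _ _ Hpq H)).
Qed.

(** * Urysohn's lemma and approximation by ramps *)

Definition ramp {X} (le : X -> X -> Prop) a b (r : X -> R) :=
  (forall x, 0 <= r x <= 1) /\ (forall x, le x a -> r x = 0) /\ (forall x, le b x -> r x = 1).

Section Bisection.
Context {X : Type} (le : X -> X -> Prop) (Hle : total_order le) (mid : X * X -> X).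

Definition right_half p t : bool :=
  if excluded_middle_informative (le t (mid p)) then false else true.

Definition half p t : X * X := if right_half p t then (mid p, snd p) else (fst p, mid p).

Fixpoint halves p t n : X * X :=
  match n with O => p | S n => halves (half p t) t n end.

Definition digit p t n : R := if right_half (halves p t n) t then 1 else 0.

(** A Cantor function: the binary expansion whose digits tell on which side of the successive
    midpoints [t] lies. A midpoint counts as left. *)
Definition bisect p t : R := Series (fun n => digit p t n * (1/2) ^ S n).

Lemma digit_range p t n : 0 <= digit p t n <= 1.
Proof. unfold digit. destruct right_half; lra. Qed.

Lemma half_pow_sum : is_series (fun n => (1/2) ^ S n) 1.
Proof.
  pose proof (is_series_geom (1/2) ltac:(rewrite Rabs_pos_eq; lra)) as H.
  pose proof (is_series_scal_l (1/2) _ _ H) as H1.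
  replace (/ (1 - 1/2)) with 2 in H1 by field.
  change (is_series (fun n => (1/2) ^ S n) (1/2 * 2)) in H1.
  replace (1/2 * 2) with 1 in H1 by lra. exact H1.
Qed.

Lemma digits_bound p t n : 0 <= digit p t n * (1/2) ^ S n <= (1/2) ^ S n.
Proof.
  pose proof (digit_range p t n). pose proof (pow_lt (1/2) (S n) ltac:(lra)).
  split; [apply Rmult_le_pos; lra|]. rewrite <- (Rmult_1_l ((1/2) ^ S n)) at 2.
  apply Rmult_le_compat_r; lra.
Qed.

Lemma digits_summable p t : ex_series (fun n => digit p t n * (1/2) ^ S n).
Proof.
  apply (ex_series_le (fun n => digit p t n * (1/2) ^ S n) (fun n => (1/2) ^ S n)).
  - intros n. change (Rabs (digit p t n * (1/2) ^ S n) <= (1/2) ^ S n).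
    rewrite Rabs_pos_eq; apply digits_bound.
  - exists 1. exact half_pow_sum.
Qed.

Lemma bisect_range p t : 0 <= bisect p t <= 1.
Proof.
  unfold bisect. split.
  - replace 0 with (Series (fun _ => 0)) by
      (apply is_series_unique, is_series_Reals; intros e He; exists O; intros n _;
       rewrite sum_cte, Rmult_0_l; unfold Rdist; rewrite Rminus_diag, Rabs_R0; exact He).
    apply Series_le; [|apply digits_summable].
    intros n; split; [lra|apply digits_bound].
  - apply Rle_trans with (Series (fun n => (1/2) ^ S n));
      [|right; apply is_series_unique, half_pow_sum].
    apply Series_le; [apply digits_bound|exists 1; exact half_pow_sum].
Qed.

Lemma bisect_half p t :
  bisect p t = (if right_half p t then 1/2 else 0) + bisect (half p t) t / 2.
Proof.
  unfold bisect at 1. rewrite Series_incr_1 by apply digits_summable. f_equal.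
  - unfold digit; simpl. destruct right_half; lra.
  - replace (bisect (half p t) t / 2) with (1/2 * bisect (half p t) t) by lra.
    unfold bisect. rewrite <- Series_scal_l.
    apply Series_ext. intros n. change (digit p t (S n)) with (digit (half p t) t n).
    simpl. lra.
Qed.

Context (a b : X).
Hypothesis Hmid : forall p, le a (fst p) -> lt le (fst p) (snd p) -> le (snd p) b ->
  lt le (fst p) (mid p) /\ lt le (mid p) (snd p).

Definition in_range (p : X * X) := le a (fst p) /\ lt le (fst p) (snd p) /\ le (snd p) b.

Lemma in_range_left p : in_range p -> in_range (fst p, mid p).
Proof.
  destruct Hle as (Hr & Ha & Ht & _). intros (H1 & H2 & H3).
  destruct (Hmid p H1 H2 H3) as [[H4 H4'] [H5 H5']]. repeat split; simpl; eauto.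
Qed.

Lemma in_range_right p : in_range p -> in_range (mid p, snd p).
Proof.
  destruct Hle as (Hr & Ha & Ht & _). intros (H1 & H2 & H3).
  destruct (Hmid p H1 H2 H3) as [[H4 H4'] [H5 H5']]. repeat split; simpl; eauto.
Qed.

Lemma bisect_left p t :
  le t (mid p) -> bisect p t = bisect (fst p, mid p) t / 2.
Proof.
  intros H. rewrite bisect_half. unfold half, right_half.
  destruct excluded_middle_informative; [lra|contradiction].
Qed.

Lemma bisect_right p t :
  lt le (mid p) t -> bisect p t = 1/2 + bisect (mid p, snd p) t / 2.
Proof.
  intros H. rewrite bisect_half. unfold half, right_half.
  destruct excluded_middle_informative; [|lra].
  exfalso; exact (lt_not_le Hle _ _ H l).
Qed.

(** A point up to the left end always falls into left halves, which halves its value at each step;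
    symmetrically at the right end. After [n] steps the trivial bounds 0 and 1 leave an error of at
    most [(1/2) ^ n]. *)
Lemma bisect_ends p : in_range p ->
  (forall t, le t (fst p) -> bisect p t = 0) /\ (forall t, le (snd p) t -> bisect p t = 1).
Proof.
  intros Hp.
  assert (H : forall n p, in_range p ->
    (forall t, le t (fst p) -> bisect p t <= (1/2) ^ n) /\
    (forall t, le (snd p) t -> 1 - (1/2) ^ n <= bisect p t)).
  { clear p Hp. induction n as [|n IH]; intros p Hp.
    - simpl. split; intros t _; pose proof (bisect_range p t); lra.
    - pose proof Hp as (H1 & H2 & H3). destruct (Hmid p H1 H2 H3) as [H4 H5]. split; intros t Ht.
      + rewrite bisect_left by (destruct Hle as (_ & _ & Htr & _); destruct H4; eauto).
        destruct (IH _ (in_range_left p Hp)) as [IH1 _]. specialize (IH1 t Ht). simpl. lra.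
      + rewrite bisect_right by (eapply (lt_le_trans Hle); eauto).
        destruct (IH _ (in_range_right p Hp)) as [_ IH1]. specialize (IH1 t Ht). simpl. lra. }
  assert (Hlim : forall x, (forall n, x <= (1/2) ^ n) -> x <= 0).
  { intros x Hx. destruct (Rle_or_lt x 0) as [Hx0|Hx0]; [exact Hx0|exfalso].
    destruct (pow_lt_1_zero (1/2) ltac:(rewrite Rabs_pos_eq; lra) x Hx0) as [N HN].
    specialize (HN N (le_n N)). pose proof (Rle_abs ((1/2) ^ N)). specialize (Hx N). lra. }
  split; intros t Ht; pose proof (bisect_range p t).
  - assert (bisect p t <= 0) by (apply Hlim; intros n; apply (H n p Hp), Ht). lra.
  - assert (1 - bisect p t <= 0); [|lra]. apply Hlim; intros n.
    destruct (H n p Hp) as [_ H']. specialize (H' t Ht). lra.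
Qed.

(* Away from the midpoint the oscillation is halved by self-similarity; at the
   midpoint itself the two halves are controlled separately. *)
Lemma bisect_osc n : forall p, in_range p -> forall x, exists lo hi, oint le lo hi x /\
  forall y, oint le lo hi y -> Rabs (bisect p y - bisect p x) <= (1/2) ^ n.
Proof.
  induction n as [|n IH]; intros p Hp x.
  { exists None, None; split; [split; exact I|]. intros y _. simpl.
    pose proof (bisect_range p y). pose proof (bisect_range p x). apply Rabs_le; lra. }
  pose proof (in_range_left p Hp) as Hl. pose proof (in_range_right p Hp) as Hr.
  destruct (bisect_ends _ Hl) as [_ EL]. destruct (bisect_ends _ Hr) as [ER _]. simpl in EL, ER.
  assert (Hrefl : forall z, le z z) by apply Hle.
  destruct (IH _ Hl x) as (lo1 & hi1 & Hx1 & H1).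
  destruct (IH _ Hr x) as (lo2 & hi2 & Hx2 & H2).
  destruct (oint_inter Hle _ _ _ _ _ Hx1 Hx2) as (lo & hi & Hx & Hin).
  destruct (classic (x = mid p)) as [Exm|Nxm].
  - exists lo, hi; split; [exact Hx|]. intros y Hy. destruct (Hin y Hy) as [Hy1 Hy2].
    specialize (H1 y Hy1). specialize (H2 y Hy2).
    rewrite (bisect_left p x) by (rewrite Exm; apply Hrefl).
    destruct (le_lt_cases Hle y (mid p)) as [H|H].
    + rewrite (bisect_left p y H). apply Rabs_le. apply Rabs_le_between in H1. simpl; lra.
    + rewrite (bisect_right p y H). apply Rabs_le. apply Rabs_le_between in H2. simpl.
      rewrite (EL x) by (rewrite Exm; apply Hrefl).
      rewrite (ER x) in H2 by (rewrite Exm; apply Hrefl). lra.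
  - destruct (le_lt_cases Hle x (mid p)) as [Hxm|Hxm].
    + assert (Hxin : oint le None (Some (mid p)) x) by (split; [exact I|split; assumption]).
      destruct (oint_inter Hle _ _ _ _ _ Hx Hxin) as (l & h & Hx' & Hin').
      exists l, h; split; [exact Hx'|]. intros y Hy. destruct (Hin' y Hy) as [Hy1 [_ Hy2]].
      rewrite (bisect_left p x Hxm), (bisect_left p y (proj1 Hy2)).
      specialize (H1 y (proj1 (Hin y Hy1))). apply Rabs_le. apply Rabs_le_between in H1. simpl; lra.
    + assert (Hxin : oint le (Some (mid p)) None x) by (split; [assumption|exact I]).
      destruct (oint_inter Hle _ _ _ _ _ Hx Hxin) as (l & h & Hx' & Hin').
      exists l, h; split; [exact Hx'|]. intros y Hy. destruct (Hin' y Hy) as [Hy1 [Hy2 _]].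
      rewrite (bisect_right p x Hxm), (bisect_right p y Hy2).
      specialize (H2 y (proj2 (Hin y Hy1))). apply Rabs_le. apply Rabs_le_between in H2. simpl; lra.
Qed.

End Bisection.

(** If there is a gap between [a] and [b], the indicator of its upper side serves. Otherwise every
    subinterval has an inner point, and bisection at chosen inner points gives the function. *)
Lemma ordered_urysohn {X} {le : X -> X -> Prop} (Hle : total_order le) a b :
  lt le a b -> exists r, cont_real le r /\ ramp le a b r.
Proof.
  intros Hab. pose proof Hle as (Hrf & Han & Htr & Hto).
  destruct (classic (exists p q, le a p /\ le q b /\ adjacent le p q))
    as [(p & q & Hap & Hqb & Hpq)|Hdense].
  - exists (fun x => 1 * 1 + (-1) * step_le le p x). split.
    + apply (cont_real_lin Hle); [apply cont_real_const|apply (cont_step_le p q Hle Hpq)].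
    + split; [|split]; intros x.
      * pose proof (step_le_range le p x). lra.
      * intros Hx. rewrite step_le_1; [lra|eauto].
      * intros Hx. rewrite step_le_0; [lra|]. apply (lt_not_le Hle).
        apply (lt_le_trans Hle _ q); [apply Hpq|eauto].
  (* The conditions on the pair stand inside the existential, so that choice yields a midpoint
     function defined on all pairs. *)
  - assert (Hex : forall p : X * X, exists m, le a (fst p) -> lt le (fst p) (snd p) ->
      le (snd p) b -> lt le (fst p) m /\ lt le m (snd p)).
    { intros [p q]; simpl. apply NNPP; intros Hn.
      assert (H : forall m, (le a p /\ lt le p q /\ le q b) /\ ~ (lt le p m /\ lt le m q)).
      { intros m. apply NNPP. intros H. apply Hn. exists m. intros H1 H2 H3.
        apply NNPP. intros H4. apply H. tauto. }
      apply Hdense. exists p, q. destruct (H p) as [(H1 & H2 & H3) _].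
      split; [exact H1|split; [exact H3|split; [exact H2|]]]. intros z.
      destruct (H z) as [_ Hz]. destruct (le_lt_cases Hle z p); [left; assumption|].
      destruct (le_lt_cases Hle q z); [right; assumption|]. tauto. }
    pose (mid := fun p => proj1_sig (constructive_indefinite_description _ (Hex p))).
    assert (Hmid : forall p, le a (fst p) -> lt le (fst p) (snd p) ->
      le (snd p) b -> lt le (fst p) (mid p) /\ lt le (mid p) (snd p)).
    { intros p. unfold mid. destruct constructive_indefinite_description; assumption. }
    assert (Hin : in_range le a b (a, b)) by (split; [apply Hrf|split; [exact Hab|apply Hrf]]).
    exists (bisect le mid (a, b)). split.
    + apply cont_real_iff. intros x eps Heps.
      destruct (pow_lt_1_zero (1/2) ltac:(rewrite Rabs_pos_eq; lra) eps Heps) as [N HN].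
      specialize (HN N (le_n N)). pose proof (Rle_abs ((1/2) ^ N)).
      destruct (bisect_osc le Hle mid a b Hmid N (a, b) Hin x) as (lo & hi & H1 & H2).
      exists lo, hi; split; [exact H1|]. intros y Hy. specialize (H2 y Hy). lra.
    + destruct (bisect_ends le Hle mid a b Hmid (a, b) Hin) as [H1 H2].
      split; [apply bisect_range|split; [exact H1|exact H2]].
Qed.

Definition subspace {X} (D : (X -> R) -> Prop) :=
  D (fun _ => 0) /\ forall g h a b, D g -> D h -> D (fun x => a * g x + b * h x).

(* Interpolation of [g] by ramps between finitely many points, any two
   consecutive ones being adjacent or spanning a set of small oscillation. *)
Lemma ramps_dense {X} {le : X -> X -> Prop} (S : (X -> R) -> Prop) (g : X -> R) eps :
  complete_line le -> subspace S -> S (fun _ => 1) ->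
  (forall x y, lt le x y -> exists r, S r /\ ramp le x y r) ->
  cont_real le g -> 0 < eps ->
  exists f, S f /\ forall x, Rabs (g x - f x) <= eps.
Proof.
  intros Hcl HS S1 Hramp Hg Heps. pose proof (proj1 Hcl) as Hle.
  pose proof Hle as (Hr & Ha & Ht & Hto).
  (* The interpolant up to [x] stays constant with value [g x] beyond [x], so that adding a multiple
     of a ramp continues it to [y]. *)
  destruct (complete_line_induction
    (fun x => exists f, S f /\ (forall y, le y x -> Rabs (g y - f y) <= eps) /\
       forall y, le x y -> f y = g x)
    (fun x y => forall z, le x z -> le z y ->
       Rabs (g z - g x) <= eps /\ Rabs (g z - g y) <= eps \/ z = x \/ z = y) Hcl)
    as (z & (f & Sf & Hf & _) & Hz).
  - intros b Hb. exists (fun _ => g b * 1 + 0 * 1). split; [apply HS; exact S1|split].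
    + intros y Hy. rewrite (Ha y b Hy (Hb y)).
      replace (g b - _) with 0 by lra. rewrite Rabs_R0; lra.
    + intros; lra.
  - intros x y (f & Sf & Hf & Hfx) Hxy Hgood. destruct (Hramp x y Hxy) as (r & Sr & R01 & R0 & R1).
    exists (fun z => 1 * f z + (g y - g x) * r z). split; [apply HS; assumption|split].
    + intros z Hzy. destruct (Hto z x) as [H|H].
      * rewrite (R0 z H). replace (g z - _) with (g z - f z) by lra. apply Hf, H.
      * rewrite (Hfx z H). destruct (Hgood z H Hzy) as [[G1 G2]|[->| ->]].
        -- specialize (R01 z). apply Rabs_le_between in G1. apply Rabs_le_between in G2.
           (* The error is a convex combination of the deviations of [g z] from [g x] and from
              [g y]. *)
           replace (g z - (1 * g x + (g y - g x) * r z)) with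
             ((1 - r z) * (g z - g x) + r z * (g z - g y)) by ring.
           apply Rabs_le. split; nra.
        -- rewrite (R0 x (Hr x)). replace (g x - _) with 0 by lra. rewrite Rabs_R0; lra.
        -- rewrite (R1 y (Hr y)). replace (g y - _) with 0 by lra. rewrite Rabs_R0; lra.
    + intros z Hyz. rewrite (R1 z Hyz), (Hfx z); [lra|]. destruct Hxy; eauto.
  - intros c. destruct (proj1 (cont_real_iff g) Hg c (eps/2) ltac:(lra)) as (lo & hi & H1 & H2).
    exists lo, hi; split; [exact H1|]. intros x y Hx Hy _ z Hxz Hzy. left.
    assert (Hz : oint le lo hi z).
    { destruct Hx as [Hx _], Hy as [_ Hy]. split.
      - destruct lo; [|exact I]. exact (lt_le_trans Hle _ _ _ Hx Hxz).
      - destruct hi; [|exact I]. exact (le_lt_trans Hle _ _ _ Hzy Hy). }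
    pose proof (H2 x Hx) as Gx. pose proof (H2 y Hy) as Gy. pose proof (H2 z Hz) as Gz.
    apply Rabs_def2 in Gx. apply Rabs_def2 in Gy. apply Rabs_def2 in Gz.
    split; apply Rabs_le; lra.
  - intros x y [_ Hxy] z Hxz Hzy. right. destruct (Hxy z) as [H|H]; [left|right]; apply Ha; assumption.
  - exists f. split; [exact Sf|]. intros x. apply Hf, Hz.
Qed.

(** * Extension of functionals *)

Definition bounded_on {X} (D : (X -> R) -> Prop) (e : (X -> R) -> R) M :=
  (forall g h a b, D g -> D h -> e (fun x => a * g x + b * h x) = a * e g + b * e h) /\
  (forall g, D g -> (forall x, Rabs (g x) <= 1) -> Rabs (e g) <= M).

Definition sum_list {I} (f : I -> R) (l : list I) : R := fold_right (fun i s => f i + s) 0 l.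

Lemma sum_list_le {I} (f g : I -> R) l :
  (forall i, In i l -> f i <= g i) -> sum_list f l <= sum_list g l.
Proof.
  induction l as [|a l IH]; intros H; simpl; [lra|].
  pose proof (H a (or_introl eq_refl)). specialize (IH (fun i Hi => H i (or_intror Hi))). lra.
Qed.

Lemma sum_list_scal {I} (f : I -> R) c l : sum_list (fun i => c * f i) l = c * sum_list f l.
Proof. induction l as [|a l IH]; simpl; [lra|]. rewrite IH; lra. Qed.

Lemma sum_list_lin {I} (f g : I -> R) a b l :
  sum_list (fun i => a * f i + b * g i) l = a * sum_list f l + b * sum_list g l.
Proof. induction l as [|i l IH]; simpl; [lra|]. rewrite IH; lra. Qed.

Lemma sum_list_ext {I} (f g : I -> R) l :
  (forall i, In i l -> f i = g i) -> sum_list f l = sum_list g l.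
Proof.
  intros H. apply Rle_antisym; apply sum_list_le; intros i Hi; rewrite (H i Hi); lra.
Qed.

Lemma sum_list_const {I} c (l : list I) : sum_list (fun _ => c) l = INR (length l) * c.
Proof.
  induction l as [|i l IH]; [simpl; lra|]. change (c + sum_list (fun _ => c) l = INR (S (length l)) * c).
  rewrite IH, S_INR; lra.
Qed.

Lemma Rabs_sum_list {I} (f : I -> R) l : Rabs (sum_list f l) <= sum_list (fun i => Rabs (f i)) l.
Proof.
  induction l as [|i l IH]; simpl; [rewrite Rabs_R0; lra|].
  eapply Rle_trans; [apply Rabs_triang|]. lra.
Qed.

Section Functional.
Context {X : Type} (D : (X -> R) -> Prop) (e : (X -> R) -> R) (M : R).
Hypothesis HD : subspace D.
Hypothesis He : bounded_on D e M.

Lemma bounded_on_scale g c :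
  D g -> 0 < c -> (forall x, Rabs (g x) <= c) -> Rabs (e g) <= M * c.
Proof.
  intros Dg Hc Hg. destruct He as [Hlin Hbd]. destruct HD as [D0 Dlin].
  assert (H : Rabs (e (fun x => / c * g x + 0 * g x)) <= M).
  { apply Hbd; [apply Dlin; assumption|]. intros x.
    replace (/ c * g x + 0 * g x) with (g x / c) by (field; lra).
    unfold Rdiv. rewrite Rabs_mult, (Rabs_pos_eq (/ c)) by (left; apply Rinv_0_lt_compat, Hc).
    apply (Rmult_le_reg_r c); [exact Hc|]. rewrite Rmult_assoc, Rinv_l by lra.
    specialize (Hg x); lra. }
  rewrite Hlin in H by assumption.
  replace (/ c * e g + 0 * e g) with (e g * / c) in H by ring.
  rewrite Rabs_mult, (Rabs_pos_eq (/ c)) in H by (left; apply Rinv_0_lt_compat, Hc).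
  apply (Rmult_le_compat_r c) in H; [|lra]. rewrite Rmult_assoc, Rinv_l in H by lra. lra.
Qed.

Lemma bounded_on_nonneg : 0 <= M.
Proof.
  eapply Rle_trans; [apply Rabs_pos|]. apply (proj2 He (fun _ => 0)); [apply HD|].
  intros x. rewrite Rabs_R0; lra.
Qed.

Lemma bounded_on_sum {I} (a : I -> R) (u : I -> X -> R) l :
  (forall i, In i l -> D (u i)) ->
  D (fun x => sum_list (fun i => a i * u i x) l) /\
  e (fun x => sum_list (fun i => a i * u i x) l) = sum_list (fun i => a i * e (u i)) l.
Proof.
  destruct He as [Hlin _]. destruct HD as [D0 Dlin].
  induction l as [|i l IH]; intros Hu; simpl.
  - split; [exact D0|]. pose proof (Hlin _ _ 0 0 D0 D0) as H.
    cbv beta in H. replace (fun _ : X => 0 * 0 + 0 * 0) with (fun _ : X => 0) in H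
      by (apply functional_extensionality; intros; lra).
    rewrite H; lra.
  - destruct IH as [IH1 IH2]; [intros j Hj; apply Hu; right; exact Hj|].
    pose proof (Hu i (or_introl eq_refl)) as Di.
    pose proof (Hlin _ _ (a i) 1 Di IH1) as H. pose proof (Dlin _ _ (a i) 1 Di IH1) as H'.
    simpl in H, H'.
    assert (E : (fun x => a i * u i x + 1 * sum_list (fun i => a i * u i x) l) =
      (fun x => a i * u i x + sum_list (fun i => a i * u i x) l))
      by (apply functional_extensionality; intros; lra).
    rewrite E in H, H'. split; [exact H'|]. rewrite H, IH2; lra.
Qed.

(** With the signs of the values [e (u i)] as coefficients, the sum of absolute values becomes the
    value of [e] at a single function bounded by 1. *)
Lemma sum_abs_le {I} (u : I -> X -> R) l :
  (forall i, In i l -> D (u i)) -> (forall x, sum_list (fun i => Rabs (u i x)) l <= 1) ->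
  sum_list (fun i => Rabs (e (u i))) l <= M.
Proof.
  intros Hu Hs. set (a := fun i => if Rle_dec 0 (e (u i)) then 1 else -1).
  destruct (bounded_on_sum a u l Hu) as [H1 H2].
  assert (H3 : sum_list (fun i => Rabs (e (u i))) l = sum_list (fun i => a i * e (u i)) l).
  { apply sum_list_ext. intros i _. unfold a. destruct Rle_dec as [H|H].
    - rewrite Rabs_pos_eq; lra.
    - rewrite Rabs_left; lra. }
  rewrite H3, <- H2. eapply Rle_trans; [apply Rle_abs|]. apply (proj2 He _ H1).
  intros x. eapply Rle_trans; [apply Rabs_sum_list|].
  eapply Rle_trans; [|apply (Hs x)]. apply sum_list_le. intros i _. rewrite Rabs_mult.
  unfold a. destruct Rle_dec; [rewrite Rabs_R1|rewrite (Rabs_left (-1)) by lra]; lra.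
Qed.

End Functional.

Lemma subspace_bounded {X} : subspace (@bounded_fun X).
Proof.
  split; [exists 0; intros x; rewrite Rabs_R0; lra|].
  intros g h a b [c1 H1] [c2 H2]. exists (Rabs a * c1 + Rabs b * c2).
  intros x. eapply Rle_trans; [apply Rabs_triang|]. rewrite !Rabs_mult.
  apply Rplus_le_compat; apply Rmult_le_compat_l; auto using Rabs_pos.
Qed.

Lemma zorn_subsets {T} (P : (T -> Prop) -> Prop) :
  (forall F : (T -> Prop) -> Prop, (forall A, F A -> P A) ->
     (forall A B, F A -> F B -> (forall x, A x -> B x) \/ (forall x, B x -> A x)) ->
     P (fun x => exists A, F A /\ A x)) ->
  exists A, P A /\ forall B, (forall x, A x -> B x) -> P B -> forall x, B x -> A x.
Proof.
  intros H. destruct (@classical_sets.Zorn_bigcup T P) as (A & PA & HA).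
  - intros F FP Ftot.
    replace (classical_sets.bigcup F (fun X => X)) with (fun x => exists A, F A /\ A x).
    + apply H; [exact FP|]. intros A B FA FB. exact (Ftot A B FA FB).
    + apply functional_extensionality; intros x. apply propositional_extensionality.
      split; [intros (A & FA & Ax); exists A; assumption|intros [A FA Ax]; exists A; auto].
  - exists A; split; [exact PA|]. intros B AB PB. apply NNPP; intros Hn.
    apply (HA B); [split; assumption|exact PB].
Qed.

(** Partial functionals are kept as graphs, so that the union of a chain is again one. That they are
    single-valued follows from the norm bound. *)
Definition lin_graph {X} (G : (X -> R) * R -> Prop) :=
  forall g v h w a b, G (g, v) -> G (h, w) -> G (fun x => a * g x + b * h x, a * v + b * w).

Definition graph_bound {X} (G : (X -> R) * R -> Prop) M :=
  forall g v c, G (g, v) -> 0 < c -> (forall x, Rabs (g x) <= c) -> Rabs v <= M * c.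

Lemma graph_zero {X} (G : (X -> R) * R -> Prop) p :
  lin_graph G -> G p -> G (fun _ => 0, 0).
Proof.
  destruct p as [g w]. intros HL Hp. pose proof (HL _ _ _ _ 0 0 Hp Hp) as H.
  replace (fun x => 0 * g x + 0 * g x) with (fun _ : X => 0) in H
    by (apply functional_extensionality; intros; lra).
  replace (0 * w + 0 * w) with 0 in H by lra. exact H.
Qed.

(** Two values at [g] differ by a value at the zero function, which is at most [M * c] for every
    positive [c]; the choice [c = d / (2 * (M + 1))] makes this smaller than the difference [d]. *)
Lemma graph_functional {X} (G : (X -> R) * R -> Prop) M g v w :
  lin_graph G -> graph_bound G M -> 0 <= M -> G (g, v) -> G (g, w) -> v = w.
Proof.
  intros HL HB HM Hv Hw. pose proof (HL _ _ _ _ 1 (-1) Hv Hw) as H.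
  apply Rminus_diag_uniq, NNPP. intros Hne. apply Rabs_pos_lt in Hne.
  set (d := Rabs (v - w)) in *.
  assert (Hc : 0 < d / (2 * (M + 1))) by (apply Rdiv_lt_0_compat; lra).
  specialize (HB _ _ _ H Hc).
  replace (1 * v + -1 * w) with (v - w) in HB by ring. fold d in HB.
  assert (M * (d / (2 * (M + 1))) = d / 2 - d / (2 * (M + 1))) by (field; lra).
  enough (d <= M * (d / (2 * (M + 1)))) by lra.
  apply HB. intros x. replace (1 * g x + -1 * g x) with 0 by ring. rewrite Rabs_R0; lra.
Qed.

(** The value at [h] has to lie above all [- M * c - w] and below all [M * c - w]. By the triangle
    inequality each lower bound is at most each upper bound, so the supremum of the lower bounds
    will do. *)
Lemma graph_extend_value {X} (G : (X -> R) * R -> Prop) M (h : X -> R) :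
  lin_graph G -> graph_bound G M -> (exists p, G p) -> bounded_fun h ->
  exists v, forall g w c, G (g, w) -> 0 < c -> (forall x, Rabs (g x + h x) <= c) ->
    Rabs (w + v) <= M * c.
Proof.
  intros HL HB [p Hp] [ch Hh]. pose proof (graph_zero G p HL Hp) as G0.
  set (c0 := Rmax ch 1). assert (Hc0 : 0 < c0) by (unfold c0; pose proof (Rmax_r ch 1); lra).
  assert (Hh0 : forall x, Rabs (h x) <= c0) by (intros x; eapply Rle_trans; [apply Hh|apply Rmax_l]).
  assert (key : forall g w c g' w' c', G (g, w) -> 0 < c -> (forall x, Rabs (g x + h x) <= c) ->
    G (g', w') -> 0 < c' -> (forall x, Rabs (g' x + h x) <= c') -> - M * c - w <= M * c' - w').
  { intros g w c g' w' c' Hg Hc Hgc Hg' Hc' Hgc'.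
    pose proof (HL _ _ _ _ 1 (-1) Hg' Hg) as H.
    specialize (HB _ _ (c + c') H ltac:(lra)).
    assert (Rabs (1 * w' + -1 * w) <= M * (c + c')).
    { apply HB. intros x. specialize (Hgc x). specialize (Hgc' x).
      replace (1 * g' x + -1 * g x) with ((g' x + h x) - (g x + h x)) by ring.
      unfold Rminus. eapply Rle_trans; [apply Rabs_triang|]. rewrite Rabs_Ropp; lra. }
    pose proof (Rle_abs (1 * w' + -1 * w)). lra. }
  destruct (completeness (fun r => exists g w c, G (g, w) /\ 0 < c /\
      (forall x, Rabs (g x + h x) <= c) /\ r = - M * c - w)) as [v [Hub Hlub]].
  - exists (M * c0 - 0). intros r (g & w & c & Hg & Hc & Hgc & ->).
    apply (key g w c (fun _ => 0) 0 c0); auto. intros x. rewrite Rplus_0_l; apply Hh0.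
  - exists (- M * c0 - 0), (fun _ => 0), 0, c0. repeat split; auto.
    intros x. rewrite Rplus_0_l; apply Hh0.
  - exists v. intros g w c Hg Hc Hgc. apply Rabs_le. split.
    + enough (- M * c - w <= v) by lra. apply Hub. exists g, w, c; auto.
    + enough (v <= M * c - w) by lra. apply Hlub.
      intros r (g' & w' & c' & Hg' & Hc' & Hgc' & ->). eapply key; eauto.
Qed.

(** Extending to all bounded functions, and not just to continuous ones, allows the functional to be
    tested later on arbitrary bounded functions supported in a node. *)
Lemma hahn_banach {X} (D : (X -> R) -> Prop) e M :
  subspace D -> (forall g, D g -> bounded_fun g) -> bounded_on D e M ->
  exists e', bounded_on bounded_fun e' M /\ forall g, D g -> e' g = e g.
Proof.
  intros HD HDb He. pose proof (bounded_on_nonneg D e M HD He) as HM.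
  set (G0 := fun p : (X -> R) * R => D (fst p) /\ snd p = e (fst p)).
  assert (G0lin : lin_graph G0).
  { intros g v h w a b [Dg Hg] [Dh Hh]; simpl in *; subst. split; simpl; [apply HD; assumption|].
    symmetry; apply He; assumption. }
  assert (G0b : graph_bound G0 M).
  { intros g v c [Dg Hg] Hc Hgc; simpl in *; subst. apply (bounded_on_scale D e M HD He); assumption. }
  assert (G00 : G0 (fun _ => 0, e (fun _ => 0))) by (split; [apply HD|reflexivity]).
  (* Zorn's lemma is used with the empty chain among the chains, so only nonempty graphs are asked
     to contain [G0]; maximality then rules out the empty graph. *)
  destruct (zorn_subsets (fun G => lin_graph G /\ graph_bound G M /\
     forall p, G p -> forall q, G0 q -> G q)) as (G & (GL & GB & G0G) & Gmax).
  { intros F HF Ftot. split; [|split].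
    - intros g v h w a b (A & FA & HA) (B & FB & HB).
      destruct (Ftot A B FA FB) as [H|H];
        [exists B; split; [exact FB|]; apply (proj1 (HF B FB))
        |exists A; split; [exact FA|]; apply (proj1 (HF A FA))]; auto.
    - intros g v c (A & FA & HA). apply (HF A FA); assumption.
    - intros p (A & FA & HA) q Hq. exists A; split; [exact FA|].
      destruct (HF A FA) as (_ & _ & H). exact (H p HA q Hq). }
  assert (Gne : exists p, G p).
  { apply NNPP; intros Hn. apply Hn. exists (fun _ => 0, e (fun _ => 0)). apply (Gmax G0); auto.
    intros p Hp; exfalso; apply Hn; exists p; exact Hp. }
  assert (G0sub : forall q, G0 q -> G q) by (destruct Gne as [p Hp]; eauto).
  assert (Gtot : forall h, bounded_fun h -> exists v, G (h, v)).
  { intros h Hh. destruct (graph_extend_value G M h GL GB Gne Hh) as [v Hv]. exists v.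
    set (G' := fun p : (X -> R) * R => exists g w t, G (g, w) /\
      fst p = (fun x => g x + t * h x) /\ snd p = w + t * v).
    assert (GG' : forall p, G p -> G' p).
    { intros [g w] Hp. exists g, w, 0; split; [exact Hp|]. simpl.
      split; [apply functional_extensionality; intros; lra|lra]. }
    apply (Gmax G' GG').
    - split; [|split].
      + intros g1 v1 g2 v2 a b (k1 & w1 & t1 & H1 & E1 & E1') (k2 & w2 & t2 & H2 & E2 & E2').
        simpl in *; subst. exists (fun x => a * k1 x + b * k2 x), (a * w1 + b * w2), (a * t1 + b * t2).
        split; [apply GL; assumption|]. simpl.
        split; [apply functional_extensionality; intros; ring|ring].
      + intros g1 v1 c (k & w & t & Hk & E1 & E2) Hc Hgc. simpl in *; subst.
        destruct (Req_dec t 0) as [->|Ht].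
        * rewrite Rmult_0_l, Rplus_0_r. apply (GB k); [exact Hk|exact Hc|].
          intros x. specialize (Hgc x). rewrite Rmult_0_l, Rplus_0_r in Hgc. exact Hgc.
        (* For a nonzero coefficient [t], homogeneity reduces the bound for [k + t * h] to that for
           [k / t + h], with [c / Rabs t] in place of [c]. *)
        * pose proof (GL _ _ _ _ (/ t) 0 Hk Hk) as Hk'.
          assert (Hta : 0 < Rabs t) by (apply Rabs_pos_lt, Ht).
          assert (Hct : 0 < c / Rabs t) by (apply Rdiv_lt_0_compat; assumption).
          assert (Hs : forall y z, Rabs (/ t * y + 0 * y + z) <= c / Rabs t <-> Rabs (y + t * z) <= c).
          { intros y z. replace (/ t * y + 0 * y + z) with (/ t * (y + t * z)) by (field; exact Ht).
            rewrite Rabs_mult, Rabs_inv. split; intros H.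
            - apply (Rmult_le_compat_l (Rabs t)) in H; [|lra].
              rewrite <- Rmult_assoc, Rinv_r, Rmult_1_l in H by lra.
              replace (Rabs t * (c / Rabs t)) with c in H by (field; lra). exact H.
            - unfold Rdiv. rewrite Rmult_comm. apply Rmult_le_compat_r; [|exact H].
              left; apply Rinv_0_lt_compat, Hta. }
          assert (H : Rabs (/ t * w + 0 * w + v) <= M * (c / Rabs t)).
          { apply (Hv _ _ _ Hk' Hct). intros x. apply Hs, Hgc. }
          replace (M * (c / Rabs t)) with ((M * c) / Rabs t) in H by (field; lra).
          revert H. clear Hs. replace (/ t * w + 0 * w + v) with (/ t * (w + t * v)) by (field; exact Ht).
          rewrite Rabs_mult, Rabs_inv. intros H.
          apply (Rmult_le_compat_l (Rabs t)) in H; [|lra].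
          rewrite <- Rmult_assoc, Rinv_r, Rmult_1_l in H by lra.
          replace (Rabs t * (M * c / Rabs t)) with (M * c) in H by (field; lra). exact H.
      + intros _ _ q Hq. apply GG', G0sub, Hq.
    - exists (fun x => 0), 0, 1. split.
      + destruct Gne as [p Hp]. exact (graph_zero G p GL Hp).
      + simpl. split; [apply functional_extensionality; intros; lra|lra]. }
  exists (fun h => epsilon (inhabits 0) (fun v => G (h, v))).
  assert (Hev : forall h, bounded_fun h -> G (h, epsilon (inhabits 0) (fun v => G (h, v))))
    by (intros h Hh; apply epsilon_spec, Gtot, Hh).
  split; [split|].
  - intros g h a b Hg Hh.
    apply (graph_functional G M (fun x => a * g x + b * h x)); [assumption..| |].
    + apply Hev, subspace_bounded; assumption.
    + apply GL; apply Hev; assumption.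
  - intros g Hg H1. rewrite <- (Rmult_1_r M). apply (GB g); [apply Hev, Hg|lra|exact H1].
  - intros g Dg. apply (graph_functional G M g); [assumption..|apply Hev, HDb, Dg|].
    apply G0sub. split; [exact Dg|reflexivity].
Qed.

(** * Lexicographic powers and split lines *)

Lemma least_nat (P : nat -> Prop) :
  (exists n, P n) -> exists n, P n /\ forall m, (m < n)%nat -> ~ P m.
Proof.
  intros [n Hn]. induction n as [n IH] using (well_founded_induction Nat.lt_wf_0).
  destruct (classic (exists m, (m < n)%nat /\ P m)) as [(m & Hm & Pm)|H]; [eauto|].
  exists n; split; [exact Hn|]. intros m Hm Pm. apply H; eauto.
Qed.

Definition agree {L : Type} (n : nat) (s t : nat -> L) := forall m, (m < n)%nat -> s m = t m.

Lemma agree_weaken {L} n k (s t : nat -> L) : (k <= n)%nat -> agree n s t -> agree k s t.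
Proof. intros H Hs m Hm. apply Hs; lia. Qed.

Lemma agree_sym {L} n (s t : nat -> L) : agree n s t -> agree n t s.
Proof. intros H m Hm. symmetry; auto. Qed.

Lemma agree_trans {L} n (s t u : nat -> L) : agree n s t -> agree n t u -> agree n s u.
Proof. intros H H' m Hm. rewrite H, H'; auto. Qed.

Lemma first_difference {L} (s t : nat -> L) :
  s <> t -> exists n, agree n s t /\ s n <> t n.
Proof.
  intros Hne. destruct (least_nat (fun n => s n <> t n)) as (n & Hn & Hmin).
  - apply NNPP; intros H. apply Hne, functional_extensionality. intros n.
    apply NNPP; eauto.
  - exists n; split; [|exact Hn]. intros m Hm. apply NNPP, (Hmin m Hm).
Qed.

Section Lexicographic.
Context {L : Type} (le : L -> L -> Prop) (Hcl : complete_line le).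

Lemma lex_lt s t : lt (lex le) s t <-> exists n, agree n s t /\ lt le (s n) (t n).
Proof.
  split.
  - intros [[H|H] Hne]; [|exact H]. exfalso. apply Hne, functional_extensionality, H.
  - intros (n & Hn & Hlt). split; [right; eauto|]. intros ->. destruct Hlt; congruence.
Qed.

Lemma lex_agree_le n s t : lex le s t -> agree n s t -> le (s n) (t n).
Proof.
  pose proof (proj1 Hcl) as (Hr & _). intros [H|(m & Hm & Hlt)] Hn; [rewrite H; apply Hr|].
  destruct (Nat.lt_trichotomy m n) as [H|[->|H]].
  - destruct Hlt as [_ Hlt]. contradiction (Hlt (Hn m H)).
  - apply Hlt.
  - rewrite (Hm n H); apply Hr.
Qed.

Lemma lex_total_order : total_order (lex le).
Proof.
  pose proof (proj1 Hcl) as Hle. pose proof Hle as (Hr & Ha & Ht & Hto).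
  assert (Htot : forall s t, lex le s t \/ lt (lex le) t s).
  { intros s t. destruct (classic (s = t)) as [->|Hne]; [left; left; reflexivity|].
    destruct (first_difference s t Hne) as (n & Hn & Hd).
    destruct (le_lt_cases Hle (s n) (t n)) as [H|H].
    - left; right. exists n; split; [exact Hn|split; assumption].
    - right. apply lex_lt. exists n; split; [apply agree_sym, Hn|exact H]. }
  assert (Hanti : forall s t, lt (lex le) s t -> ~ lex le t s).
  { intros s t Hst Hts. apply lex_lt in Hst. destruct Hst as (n & Hn & Hlt).
    apply (lt_not_le Hle _ _ Hlt). apply lex_agree_le; [exact Hts|apply agree_sym, Hn]. }
  repeat split.
  - intros s; left; reflexivity.
  - intros s t Hst Hts. apply NNPP; intros Hne. apply (Hanti s t); [split|]; assumption.
  - intros s t u [H|(n & Hn & Hlt)].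
    { apply functional_extensionality in H; subst; auto. }
    intros [H|(m & Hm & Hlt')].
    { apply functional_extensionality in H; subst. right; eauto. }
    destruct (Nat.lt_trichotomy m n) as [H|[->|H]].
    + right; exists m. split; [intros i Hi; rewrite Hn by lia; auto|]. rewrite Hn by lia. exact Hlt'.
    + right; exists n. split; [intros i Hi; rewrite Hn by lia; auto|].
      apply (lt_le_trans Hle _ (t n)); [exact Hlt|apply Hlt'].
    + right; exists n. split; [intros i Hi; rewrite Hn by lia; apply Hm; lia|].
      rewrite <- Hm by lia. exact Hlt.
  - intros s t. destruct (Htot s t) as [H|[H _]]; auto.
Qed.

(* The supremum is found letter by letter: the next letter is the supremum of
   the next letters of those elements that agree with the word built so far. *)
Lemma lex_complete : complete_line (lex le).
Proof.
  pose proof Hcl as [Hle Hsup]. split; [exact lex_total_order|]. intros A.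
  destruct (choice _ Hsup) as [sup Hs]. clear Hsup.
  set (next := fun n w => sup (fun z => exists x, A x /\ agree n x w /\ x n = z)).
  (* [approx n] carries the first [n] letters of the supremum, followed by a filler, the supremum of
     the empty set; stage [S n] overwrites letter [n] only. *)
  set (approx := fix approx n : nat -> L := match n with
    | O => fun _ => sup (fun _ => False)
    | S n => fun m => if Nat.eqb m n then next n (approx n) else approx n m end).
  set (s := fun n => approx (S n) n).
  assert (Happ : forall n, agree n (approx n) s).
  { induction n as [|n IH]; intros m Hm; [lia|]. destruct (Nat.eq_dec m n) as [->|Hne].
    - reflexivity.
    - simpl. rewrite (proj2 (Nat.eqb_neq m n) Hne). apply IH; lia. }
  assert (Hs' : forall n, least_upper_bound le (fun z => exists x, A x /\ agree n x s /\ x n = z) (s n)).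
  { intros n. replace (s n) with (next n (approx n)) by (unfold s; simpl; rewrite Nat.eqb_refl; reflexivity).
    unfold next. replace (fun z => exists x, A x /\ agree n x s /\ x n = z)
      with (fun z => exists x, A x /\ agree n x (approx n) /\ x n = z); [apply Hs|].
    apply functional_extensionality; intros z. apply propositional_extensionality.
    split; intros (x & H1 & H2 & H3); exists x; (split; [exact H1|split; [|exact H3]]).
    - eapply agree_trans; [exact H2|apply Happ].
    - eapply agree_trans; [exact H2|apply agree_sym, Happ]. }
  exists s; split.
  - intros x Ax. destruct (classic (x = s)) as [->|Hne]; [left; reflexivity|].
    destruct (first_difference x s Hne) as (n & Hn & Hd). right. exists n; split; [exact Hn|].
    split; [|exact Hd]. apply (Hs' n). exists x; auto.
  - intros u Hu. destruct (le_lt_cases lex_total_order s u) as [H|H]; [exact H|exfalso].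
    apply lex_lt in H. destruct H as (n & Hn & Hlt).
    apply (lt_not_le Hle _ _ Hlt). apply (Hs' n). intros z (x & Ax & Hx & <-).
    apply lex_agree_le; [apply Hu, Ax|]. eapply agree_trans; [exact Hx|apply agree_sym, Hn].
Qed.

Lemma lex_nbhd lo hi x : oint (lex le) lo hi x ->
  exists k, forall y, agree k x y -> oint (lex le) lo hi y.
Proof.
  intros [H1 H2].
  assert (exists k, forall y, agree k x y ->
    match lo with Some a => lt (lex le) a y | None => True end) as [k1 Hk1].
  { destruct lo as [a|]; [|exists O; auto]. apply lex_lt in H1. destruct H1 as (n & Hn & Hlt).
    exists (S n). intros y Hy. apply lex_lt. exists n. split.
    - eapply agree_trans; [exact Hn|]. apply (agree_weaken (S n)); [lia|exact Hy].
    - rewrite <- (Hy n) by lia. exact Hlt. }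
  assert (exists k, forall y, agree k x y ->
    match hi with Some a => lt (lex le) y a | None => True end) as [k2 Hk2].
  { destruct hi as [a|]; [|exists O; auto]. apply lex_lt in H2. destruct H2 as (n & Hn & Hlt).
    exists (S n). intros y Hy. apply lex_lt. exists n. split.
    - eapply agree_trans; [|exact Hn]. apply agree_sym, (agree_weaken (S n)); [lia|exact Hy].
    - rewrite <- (Hy n) by lia. exact Hlt. }
  exists (max k1 k2). intros y Hy. split.
  - apply Hk1. apply (agree_weaken (max k1 k2)); [lia|exact Hy].
  - apply Hk2. apply (agree_weaken (max k1 k2)); [lia|exact Hy].
Qed.

(** For [c] the least or the greatest letter this is the left or the right end of the node of length
    [k] around [x]. *)
Definition pad (c : L) (k : nat) (x : nat -> L) : nat -> L :=
  fun m => if Nat.ltb m k then x m else c.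

Lemma agree_pad c k x : agree k x (pad c k x).
Proof. intros m Hm. unfold pad. rewrite (proj2 (Nat.ltb_lt m k) Hm). reflexivity. Qed.

Lemma pad_ge c k x m : (k <= m)%nat -> pad c k x m = c.
Proof. intros H. unfold pad. rewrite (proj2 (Nat.ltb_ge m k) H). reflexivity. Qed.

Context (bot top : L) (Hbot : forall x, le bot x) (Htop : forall x, le x top).

(** At a first difference from position [k] on, the padding letter is extreme. Conversely, once the
    letters before [m] agree, letter [m] is squeezed between two equal ones. *)
Lemma agree_iff_between k x y :
  agree k x y <-> lex le (pad bot k x) y /\ lex le y (pad top k x).
Proof.
  pose proof (proj1 Hcl) as (Hr & Ha & _).
  split.
  - intros Hxy. split.
    + destruct (classic (pad bot k x = y)) as [->|Hne]; [left; reflexivity|].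
      destruct (first_difference _ _ Hne) as (n & Hn & Hd). right; exists n; split; [exact Hn|].
      split; [|exact Hd]. destruct (Nat.lt_ge_cases n k) as [H|H].
      * exfalso. apply Hd. rewrite <- (agree_pad bot k x n H). apply Hxy, H.
      * rewrite pad_ge by exact H. apply Hbot.
    + destruct (classic (y = pad top k x)) as [->|Hne]; [left; reflexivity|].
      destruct (first_difference _ _ Hne) as (n & Hn & Hd). right; exists n; split; [exact Hn|].
      split; [|exact Hd]. destruct (Nat.lt_ge_cases n k) as [H|H].
      * exfalso. apply Hd. rewrite <- (agree_pad top k x n H). symmetry; apply Hxy, H.
      * rewrite pad_ge by exact H. apply Htop.
  - intros [H1 H2] m. induction m as [m IH] using (well_founded_induction Nat.lt_wf_0). intros Hm.
    assert (Hag : agree m x y) by (intros i Hi; apply IH; lia).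
    apply Ha.
    + rewrite (agree_pad bot k x m Hm). apply lex_agree_le; [exact H1|].
      eapply agree_trans; [|exact Hag]. apply agree_sym, (agree_weaken k); [lia|apply agree_pad].
    + rewrite (agree_pad top k x m Hm). apply lex_agree_le; [exact H2|].
      eapply agree_trans; [apply agree_sym, Hag|]. apply (agree_weaken k); [lia|apply agree_pad].
Qed.

Lemma pad_lt k x : bot <> top -> lt (lex le) (pad bot k x) (pad top k x).
Proof.
  intros Hne. apply lex_lt. exists k. split.
  - eapply agree_trans; [apply agree_sym|]; apply agree_pad.
  - rewrite !pad_ge by lia. split; [apply Hbot|exact Hne].
Qed.

End Lexicographic.

(** * Doubling the points of a subset of a complete line *)

Section Splitting.
Context {K : Type} (le : K -> K -> Prop) (Hcl : complete_line le) (Q : K -> Prop).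

Definition split_line := {p : K * bool | snd p = true -> Q (fst p)}.

Definition proj (p : split_line) : K := fst (proj1_sig p).

Definition split_le (p q : split_line) : Prop :=
  lt le (proj p) (proj q) \/
  (proj p = proj q /\ (snd (proj1_sig p) = true -> snd (proj1_sig q) = true)).

Definition low (x : K) : split_line :=
  exist (fun p => snd p = true -> Q (fst p)) (x, false) (fun H => False_ind _ (Bool.diff_false_true H)).

Definition high (x : K) (H : Q x) : split_line :=
  exist (fun p => snd p = true -> Q (fst p)) (x, true) (fun _ => H).

Lemma split_line_cases (p : split_line) :
  p = low (proj p) \/ exists H, p = high (proj p) H.
Proof.
  destruct p as [[x [|]] H]; [right|left].
  - exists (H eq_refl). apply subset_eq_compat. reflexivity.
  - apply subset_eq_compat. reflexivity.
Qed.

Lemma split_total_order : total_order split_le.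
Proof.
  pose proof (proj1 Hcl) as Hle.
  assert (irr : forall x, ~ lt le x x) by (intros x [_ H]; congruence).
  repeat split.
  - intros p; right; auto.
  - intros p q [H1|[H1 H1']] [H2|[H2 H2']].
    + exfalso. exact (lt_not_le Hle _ _ H1 (proj1 H2)).
    + rewrite H2 in H1; exfalso; exact (irr _ H1).
    + rewrite H1 in H2; exfalso; exact (irr _ H2).
    + destruct p as [[x b] Hp], q as [[y c] Hq]. apply subset_eq_compat.
      unfold proj in *; simpl in *; subst. f_equal. destruct b, c; intuition.
  - intros p q r [H1|[H1 H1']] [H2|[H2 H2']].
    + left. exact (lt_le_trans Hle _ _ _ H1 (proj1 H2)).
    + left. rewrite <- H2; exact H1.
    + left. rewrite H1; exact H2.
    + right. split; [congruence|auto].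
  - intros p q. destruct (le_lt_cases Hle (proj p) (proj q)) as [H|H]; [|right; left; exact H].
    destruct (classic (proj p = proj q)) as [E|E]; [|left; left; split; assumption].
    destruct (snd (proj1_sig q)) eqn:Eq.
    + left; right; auto.
    + right; right. split; [auto|]. intros H'; congruence.
Qed.

Lemma proj_increasing : order_increasing split_le le proj.
Proof. intros p q [[H _]|[H _]]; [exact H|rewrite H; apply (proj1 (proj1 Hcl))]. Qed.

Lemma proj_lt p q : lt le (proj p) (proj q) -> lt split_le p q.
Proof. intros H; split; [left; exact H|]. intros ->. destruct H; congruence. Qed.

Lemma proj_onto : onto proj.
Proof. intros x. exists (low x). reflexivity. Qed.

Lemma low_le x p : le x (proj p) -> split_le (low x) p.
Proof.
  intros H. destruct (classic (x = proj p)) as [E|E].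
  - right. split; [exact E|]. intros H'; discriminate.
  - left. split; assumption.
Qed.

Lemma low_adjacent x (H : Q x) : adjacent split_le (low x) (high x H).
Proof.
  split.
  - split; [apply low_le; apply (proj1 (proj1 Hcl))|]. intros E.
    apply (f_equal (fun p => snd (proj1_sig p))) in E. discriminate.
  - intros p. destruct (le_lt_cases (proj1 Hcl) (proj p) x) as [Hp|Hp]; [|right; left; exact Hp].
    destruct (classic (proj p = x)) as [E|E]; [|left; left; split; assumption].
    destruct (snd (proj1_sig p)) eqn:Ep.
    + right; right. split; [symmetry; exact E|auto].
    + left; right. split; [exact E|]. intros; congruence.
Qed.

(** Over the supremum [x] of the projections the upper copy is taken only if it belongs to [A];
    otherwise the lower copy already bounds every element of [A] over [x]. *)
Lemma split_complete : complete_line split_le.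
Proof.
  split; [exact split_total_order|]. intros A.
  destruct (proj2 Hcl (fun x => exists p, A p /\ proj p = x)) as [x [Hub Hlub]].
  assert (Hle : forall u, upper_bound split_le A u -> le x (proj u)).
  { intros u Hu. apply Hlub. intros y (p & Ap & <-). apply proj_increasing, Hu, Ap. }
  destruct (classic (exists H, A (high x H))) as [[H Ah]|Hn].
  - exists (high x H). split; [|intros u Hu; apply Hu, Ah].
    intros p Ap. destruct (classic (proj p = x)) as [E|E]; [right; auto|].
    left. split; [apply Hub; eauto|exact E].
  - exists (low x). split; [|intros u Hu; apply low_le, Hle, Hu].
    intros p Ap. destruct (classic (proj p = x)) as [E|E].
    + destruct (split_line_cases p) as [->|[H Hp]]; [right; auto|].
      exfalso; apply Hn. subst x. exists H. rewrite <- Hp. exact Ap.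
    + left. split; [apply Hub; eauto|exact E].
Qed.

Lemma proj_continuous : order_continuous split_le le proj.
Proof.
  intros U HU p Hp. destruct (HU _ Hp) as (lo & hi & [H1 H2] & Hin).
  pose proof (proj1 Hcl) as Hle.
  (* The lifted interval must exclude both copies of its ends: a left end in [Q] is lifted to its
     upper copy, a right end to its lower copy. *)
  exists (match lo with None => None | Some a =>
     match excluded_middle_informative (Q a) with left H => Some (high a H) | right _ => Some (low a) end end).
  exists (option_map low hi). split.
  - split.
    + destruct lo as [a|]; [|exact I]. destruct excluded_middle_informative; apply proj_lt, H1.
    + destruct hi as [b|]; [|exact I]. apply proj_lt, H2.
  - intros q [Hq1 Hq2]. apply Hin. split.
    + destruct lo as [a|]; [|exact I]. destruct excluded_middle_informative as [Qa|Qa].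
      * destruct Hq1 as [[H|[H H']] Hne]; [exact H|]. exfalso. apply Hne.
        destruct (split_line_cases q) as [E|[Hq E]]; rewrite E in *; simpl in *.
        -- discriminate (H' eq_refl).
        -- unfold proj in H; simpl in H. apply subset_eq_compat. simpl. unfold proj; congruence.
      * destruct Hq1 as [[H|[H H']] Hne]; [exact H|]. exfalso. apply Hne.
        destruct (split_line_cases q) as [E|[Hq E]].
        -- rewrite E, <- H. reflexivity.
        -- exfalso; apply Qa. unfold proj in H at 1; simpl in H. rewrite H. exact Hq.
    + destruct hi as [b|]; [|exact I]. simpl in Hq2.
      destruct (le_lt_cases Hle b (proj q)) as [H|H]; [|exact H].
      exfalso. exact (lt_not_le split_total_order _ _ Hq2 (low_le b q H)).
Qed.

Lemma split_lt_cases p q : lt split_le p q ->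
  lt le (proj p) (proj q) \/ exists x (H : Q x), p = low x /\ q = high x H.
Proof.
  intros [[H|[H H']] Hne]; [left; exact H|right].
  destruct (split_line_cases p) as [Ep|[Hp Ep]], (split_line_cases q) as [Eq|[Hq Eq]].
  - exfalso; apply Hne. rewrite Ep, Eq, H. reflexivity.
  - exists (proj q), Hq. split; [rewrite <- H; exact Ep|exact Eq].
  - exfalso. rewrite Ep, Eq in H'. discriminate (H' eq_refl).
  - exfalso; apply Hne. rewrite Ep, Eq. apply subset_eq_compat. rewrite H. reflexivity.
Qed.

End Splitting.

(** * Countable sets and the first uncountable ordinal *)

Lemma countable_set_sub {X} (A B : X -> Prop) :
  (forall x, A x -> B x) -> countable_set B -> countable_set A.
Proof. intros H [f Hf]. exists f. auto. Qed.

Lemma countable_set_bigunion {I X} (B : I -> Prop) (A : I -> X -> Prop) :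
  countable_set B -> (forall i, B i -> countable_set (A i)) ->
  countable_set (fun x => exists i, B i /\ A i x).
Proof.
  intros [g Hg] HA.
  destruct (classic (exists i, B i)) as [[i0 Hi0]|Hn].
  2: { exists (fun _ => O). intros x y (i & Hi & _). exfalso; eauto. }
  assert (HA' : forall i, exists h : X -> nat, B i -> forall x y, A i x -> A i y -> h x = h y -> x = y).
  { intros i. destruct (classic (B i)) as [Hi|Hi]; [|exists (fun _ => O); tauto].
    destruct (HA i Hi) as [h Hh]. exists h; auto. }
  destruct (choice _ HA') as [h Hh].
  (* Each point of the union gets one index, and is coded by the code of this index and its own code
     there; [i0] is a default outside the union. *)
  assert (Hc : forall x, exists i, (exists j, B j /\ A j x) -> B i /\ A i x).
  { intros x. destruct (classic (exists j, B j /\ A j x)) as [[j Hj]|Hj]; [exists j; auto|].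
    exists i0; tauto. }
  destruct (choice _ Hc) as [c Hc'].
  exists (fun x => to_nat (g (c x), h (c x) x)).
  intros x y Hx Hy E. apply to_nat_inj in E. injection E as E1 E2.
  destruct (Hc' x Hx) as [Bx Ax]. destruct (Hc' y Hy) as [By Ay].
  apply Hg in E1; [|assumption..]. rewrite <- E1 in *. eapply Hh; eassumption.
Qed.

Lemma countable_set_nat (B : nat -> Prop) : countable_set B.
Proof. exists (fun n => n). auto. Qed.

Lemma countable_set_union {X} (A : nat -> X -> Prop) :
  (forall n, countable_set (A n)) -> countable_set (fun x => exists n, A n x).
Proof.
  intros H. apply (countable_set_sub _ (fun x => exists n, True /\ A n x)).
  - intros x [n Hn]; eauto.
  - apply countable_set_bigunion; [apply countable_set_nat|auto].
Qed.

Lemma countable_set_image {I X} (B : I -> Prop) (f : I -> X) :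
  countable_set B -> countable_set (fun x => exists i, B i /\ f i = x).
Proof.
  intros HB. apply countable_set_bigunion; [exact HB|]. intros i _.
  exists (fun _ => O). intros; subst; congruence.
Qed.

Lemma countable_set_list {X} (l : list X) : countable_set (fun x => In x l).
Proof.
  apply (countable_set_sub _ (fun x => exists n, nth_error l n = Some x)).
  - intros x Hx. apply In_nth_error, Hx.
  - apply countable_set_union. intros n. exists (fun _ => O). intros; congruence.
Qed.

Lemma countable_set_or {X} (A B : X -> Prop) :
  countable_set A -> countable_set B -> countable_set (fun x => A x \/ B x).
Proof.
  intros HA HB.
  apply (countable_set_sub _ (fun x => exists n, match n with O => A x | S _ => B x end)).
  - intros x [H|H]; [exists O|exists 1%nat]; exact H.
  - apply countable_set_union. intros [|n]; assumption.
Qed.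

(** If no finite net exists, greedy choice never stops. With equality for [E] this finds many
    elements of an uncountable set; with agreement of initial words it bounds the number of charged
    nodes. *)
Lemma net_or_separated {X} (P : X -> Prop) (E : X -> X -> Prop) :
  (exists l, (forall x, In x l -> P x) /\ forall x, P x -> exists y, In y l /\ E x y) \/
  (forall N, exists l, length l = N /\ (forall x, In x l -> P x) /\
     ForallOrdPairs (fun x y => ~ E x y) l).
Proof.
  destruct (classic (exists l, (forall x, In x l -> P x) /\ forall x, P x -> exists y, In y l /\ E x y))
    as [H|H]; [left; exact H|right].
  induction N as [|N (l & Hl & HP & HE)].
  - exists nil. repeat split; [intros x []|constructor].
  - assert (exists x, P x /\ forall y, In y l -> ~ E x y) as (x & Px & Hx).
    { apply NNPP; intros Hn. apply H. exists l; split; [exact HP|]. intros x Px.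
      apply NNPP; intros Hn'. apply Hn. exists x; split; [exact Px|]. eauto. }
    exists (x :: l). split; [simpl; congruence|split].
    + intros y [<-|Hy]; auto.
    + constructor; [|exact HE]. apply Forall_forall. exact Hx.
Qed.

Lemma not_countable_arbitrarily_long {X} (P : X -> Prop) :
  ~ countable_set P -> forall N, exists l, length l = N /\ (forall x, In x l -> P x) /\ NoDup l.
Proof.
  intros HP N. destruct (net_or_separated P eq) as [(l & _ & Hl)|H].
  - exfalso. apply HP, (countable_set_sub _ (fun x => In x l)); [|apply countable_set_list].
    intros x Px. destruct (Hl x Px) as (y & Hy & ->). exact Hy.
  - destruct (H N) as (l & H1 & H2 & H3). exists l. rewrite NoDup_iff_ForallOrdPairs. auto.
Qed.

Lemma well_order_exists (X : Type) : exists ltX : X -> X -> Prop,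
  well_founded ltX /\ (forall x y z, ltX x y -> ltX y z -> ltX x z) /\
  (forall x y, ltX x y \/ x = y \/ ltX y x).
Proof.
  destruct (wochoice.well_ordering_principle (boolp.boolp_classicType__canonical__eqtype_Equality X))
    as [R HR].
  (* Nonempty sets have unique least elements; applied to sets of one, two and three points this
     yields the axioms of a linear order. *)
  assert (Hmin : forall A : X -> Prop, (exists x, A x) ->
    exists z, A z /\ (forall x, A x -> R z x = true) /\
      forall z', A z' -> (forall x, A x -> R z' x = true) -> z = z').
  { intros A [x Hx].
    assert (HA : forall z, boolp.asbool (A z) = true <-> A z).
    { intros z; split; intros H.
      - exact (ssrbool.elimT (boolp.asboolP _) H).
      - exact (ssrbool.introT (boolp.asboolP _) H). }
    destruct (HR (fun z => boolp.asbool (A z))) as (z & [Hz1 Hz2] & Hz).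
    - exists x. apply HA, Hx.
    - exists z. split; [apply HA, Hz1|split].
      + intros y Hy. apply Hz2, HA, Hy.
      + intros z' Hz' Hl. apply Hz. split; [apply HA, Hz'|].
        intros y Hy. apply Hl, HA, Hy. }
  clear HR.
  assert (Hr : forall x, R x x = true).
  { intros x. destruct (Hmin (fun y => y = x)) as (z & -> & H & _); eauto. }
  assert (Hto : forall x y, R x y = true \/ R y x = true).
  { intros x y. destruct (Hmin (fun z => z = x \/ z = y)) as (z & [-> | ->] & H & _); eauto. }
  assert (Ha : forall x y, R x y = true -> R y x = true -> x = y).
  { intros x y Hxy Hyx. destruct (Hmin (fun z => z = x \/ z = y)) as (z & _ & _ & H); [eauto|].
    rewrite <- (H x), <- (H y); auto; intros z' [-> | ->]; auto. }
  assert (Ht : forall x y z, R x y = true -> R y z = true -> R x z = true).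
  { intros x y z Hxy Hyz.
    destruct (Hmin (fun w => w = x \/ w = y \/ w = z)) as (w & [-> |[-> | ->]] & H & _); eauto.
    - rewrite (Ha x y Hxy) by auto. exact Hyz.
    - rewrite <- (Ha y z Hyz) by auto. exact Hxy. }
  exists (fun x y => R x y = true /\ x <> y). split; [|split].
  - intros x. apply NNPP; intros Hx.
    destruct (Hmin (fun y => ~ Acc (fun x y => R x y = true /\ x <> y) y)) as (z & Hz & Hl & _); [eauto|].
    apply Hz. constructor. intros y [Hy Hne]. apply NNPP; intros Hy'. apply Hne, Ha; auto.
  - intros x y z [H1 H2] [H3 H4]. split; [eauto|]. intros ->. apply H4, Ha; assumption.
  - intros x y. destruct (classic (x = y)); [auto|]. destruct (Hto x y); auto.
Qed.

(** * Enumerations of predecessors in omega_1 *)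

Section Omega1.
Context {Z : Type} (ltZ : Z -> Z -> Prop) (HZ : is_omega1 ltZ).

Lemma omega1_irrefl z : ~ ltZ z z.
Proof.
  destruct HZ as (Hwf & _). induction z as [z IH] using (well_founded_induction Hwf).
  intros H. exact (IH z H H).
Qed.

Lemma omega1_least (P : Z -> Prop) :
  (exists z, P z) -> exists z, P z /\ forall y, ltZ y z -> ~ P y.
Proof.
  destruct HZ as (Hwf & _). intros [z Hz]. revert Hz.
  induction z as [z IH] using (well_founded_induction Hwf). intros Hz.
  destruct (classic (exists y, ltZ y z /\ P y)) as [(y & Hy & Py)|H]; [eauto|].
  exists z; split; [exact Hz|]. intros y Hy Py. eauto.
Qed.

Lemma omega1_not_countable (P : Z -> Prop) : countable_set P -> exists z, ~ P z.
Proof.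
  destruct HZ as (_ & _ & _ & Hunc & _). intros [f Hf]. apply NNPP; intros Hn.
  apply Hunc. exists f. intros x y. apply Hf; apply NNPP; eauto.
Qed.

Lemma omega1_closed_segment g : countable_set (fun z => ltZ z g \/ z = g).
Proof.
  apply countable_set_or; [apply HZ|]. exists (fun _ => O). intros; congruence.
Qed.

(** The closed initial segments ending in points of [B] have a countable union, and any point
    outside lies above all of [B]. *)
Lemma omega1_bounded (B : Z -> Prop) : countable_set B -> exists g, forall b, B b -> ltZ b g.
Proof.
  intros HB. destruct (omega1_not_countable (fun z => exists b, B b /\ (ltZ z b \/ z = b))) as [g Hg].
  - apply countable_set_bigunion; [exact HB|]. intros b _. apply omega1_closed_segment.
  - exists g. intros b Hb. destruct HZ as (_ & _ & Htri & _).
    destruct (Htri b g) as [H|[->|H]]; [exact H| |]; exfalso; eauto.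
Qed.

(** The predecessor [y] is the value at numbers that code no predecessor; this is why the least
    ordinal gets no sequence. *)
Lemma segment_enumeration z y : ltZ y z -> exists c : nat -> Z, forall b, ltZ b z <-> exists k, c k = b.
Proof.
  intros Hy. destruct HZ as (_ & _ & _ & _ & Hseg). destruct (Hseg z) as [f Hf].
  destruct (choice (fun n b => ltZ b z /\ ((exists b', ltZ b' z /\ f b' = n) -> f b = n))) as [c Hc].
  - intros n. destruct (classic (exists b, ltZ b z /\ f b = n)) as [(b & Hb & E)|H];
      [exists b; auto|exists y; tauto].
  - exists c. intros b; split.
    + intros Hb. exists (f b). destruct (Hc (f b)) as [H1 H2]. apply Hf; [exact H1|exact Hb|].
      apply H2. eauto.
    + intros [k <-]. apply Hc.
Qed.

Fixpoint encode (n : nat) (s : nat -> nat) : nat :=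
  match n with O => O | S n => to_nat (encode n s, s n) end.

Lemma encode_inj n s t : encode n s = encode n t -> agree n s t.
Proof.
  induction n as [|n IH]; intros H m Hm; [lia|]. cbn [encode] in H. apply to_nat_inj in H.
  injection H as H1 H2. destruct (Nat.eq_dec m n) as [->|Hne]; [exact H2|]. apply IH; [exact H1|lia].
Qed.

(* [c a] enumerates the nonempty set of predecessors of the ordinal [a].  The
   third property replaces Fodor's lemma: if each node had only countably many
   [a] with [n a] equal to its length, closing [{0}] under all these sets would
   give a countable set [C], and its least missing ordinal, all of whose
   predecessors lie in [C], would have to belong to [C]. *)
Lemma ladder_system : exists (A : Type) (j : A -> Z) (c : A -> nat -> Z),
  (forall a b, j a = j b -> a = b) /\
  (forall a b, c a = c b -> a = b) /\
  (forall S : A -> Prop, countable_set S ->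
     countable_set (fun a => forall k, exists s, S s /\ c a k = c s k)) /\
  (forall n : A -> nat, exists a0,
     ~ countable_set (fun a => n a = n a0 /\ agree (n a0) (c a) (c a0))).
Proof.
  pose proof HZ as (Hwf & Htr & Htri & Hunc & Hseg).
  set (A := {z | exists y, ltZ y z}). set (j := fun a : A => proj1_sig a).
  assert (Hj : forall a b : A, j a = j b -> a = b).
  { intros [a Ha] [b Hb] H. apply subset_eq_compat. exact H. }
  destruct (choice (fun (a : A) (c : nat -> Z) => forall b, ltZ b (j a) <-> exists k, c k = b)) as [c Hc].
  { intros [z [y Hy]]. exact (segment_enumeration z y Hy). }
  assert (Hjc : forall a k, ltZ (c a k) (j a)) by (intros a k; apply Hc; eauto).
  exists A, j, c. split; [exact Hj|split; [|split]].
  (* If [j a] precedes [j b], it is a value of [c b], hence of [c a], whose values all precede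
     [j a]. *)
  - intros a b E. apply Hj.
    destruct (Htri (j a) (j b)) as [H|[H|H]]; [exfalso|exact H|exfalso];
      apply Hc in H; [rewrite <- E in H|rewrite E in H]; apply Hc in H; exact (omega1_irrefl _ H).
  - intros S HS.
    destruct (omega1_bounded (fun z => exists k s, S s /\ c s k = z)) as [g Hg].
    { apply countable_set_union. intros k. apply countable_set_image, HS. }
    destruct (omega1_closed_segment g) as [f Hf]. exists (fun a => f (j a)).
    (* If the bound [g] of all letters from [S] preceded [j a], it would itself be a letter of
       [c a], hence of some [c s], and so precede itself. *)
    assert (H : forall a, (forall k, exists s, S s /\ c a k = c s k) -> ltZ (j a) g \/ j a = g).
    { intros a Ha. destruct (Htri (j a) g) as [H|[H|H]]; [auto|auto|exfalso].
      apply Hc in H. destruct H as [k Hk]. destruct (Ha k) as (s & Ss & Es).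
      apply (omega1_irrefl g). apply Hg. exists k, s. split; [exact Ss|congruence]. }
    intros a b Ha Hb E. apply Hj, Hf; auto.
  - intros n. apply NNPP; intros Hn.
    destruct (omega1_least (fun _ => True)) as (z0 & _ & Hz0).
    { destruct (omega1_not_countable (fun _ => False)) as [z _]; [|eauto].
      exists (fun _ => O). intros x y []. }
    set (C := fix C k : Z -> Prop := match k with
      | O => fun z => z = z0
      | S k => fun z => C k z \/ exists a, j a = z /\ forall m, (m < n a)%nat -> C k (c a m) end).
    assert (HC : forall k, countable_set (C k)).
    { induction k as [|k IH]; [exists (fun _ => O); simpl; intros; congruence|].
      apply countable_set_or; [exact IH|].
      apply (countable_set_sub _ (fun z => exists a, (forall m, (m < n a)%nat -> C k (c a m)) /\ j a = z));
        [intros z (a & H1 & H2); eauto|].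
      apply countable_set_image. destruct IH as [f Hf].
      (* Words of length [N] over the countable stage have countably many codes [v]. All [a] with
         given [N] and [v] share one node of length [n a], so [Hn] makes each such class
         countable. *)
      apply (countable_set_sub _ (fun a => exists N v,
        (forall m, (m < n a)%nat -> C k (c a m)) /\ n a = N /\ encode N (fun m => f (c a m)) = v)).
      { intros a Ha. eauto 6. }
      apply countable_set_union; intros N. apply countable_set_union; intros v.
      match goal with |- countable_set ?P => set (B := P) end.
      destruct (classic (exists a, B a)) as [[a0 (H0 & E0 & V0)]|HB].
      - apply NNPP; intros Hunc'. apply Hn. exists a0. intros H. apply Hunc'.
        revert H. apply countable_set_sub. intros a (Ha & Ea & Va). split; [congruence|].
        intros m Hm. apply Hf; [apply Ha; congruence|apply H0, Hm|].
        rewrite E0 in Hm. refine (encode_inj N (fun m => f (c a m)) (fun m => f (c a0 m)) _ m Hm). congruence.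
      - exists (fun _ => O). intros x y Hx. exfalso; eauto. }
    assert (Cmono : forall k l z, (k <= l)%nat -> C k z -> C l z).
    { intros k l z Hkl Hk. induction Hkl; [exact Hk|left; exact IHHkl]. }
    destruct (omega1_not_countable (fun z => exists k, C k z)) as [z1 Hz1].
    { apply countable_set_union, HC. }
    destruct (omega1_least (fun z => ~ exists k, C k z)) as (z & Hz & Hzl); [eauto|].
    assert (Hpos : ltZ z0 z).
    { destruct (Htri z0 z) as [H|[H|H]]; [exact H| |exfalso; exact (Hz0 z H I)].
      exfalso; apply Hz. exists O. simpl. congruence. }
    set (a := exist _ z (ex_intro _ z0 Hpos) : A).
    (* Only the first [n a] letters matter for entering [C], and finitely many letters occur
       together at some finite stage. *)
    assert (Hk : forall N, exists k, forall m, (m < N)%nat -> C k (c a m)).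
    { induction N as [|N [k IH]]; [exists O; intros; lia|].
      assert (exists k', C k' (c a N)) as [k' Hk'] by (apply NNPP, Hzl; exact (Hjc a N)).
      exists (max k k'). intros m Hm. destruct (Nat.eq_dec m N) as [->|Hne].
      - apply (Cmono k'); [lia|exact Hk'].
      - apply (Cmono k); [lia|apply IH; lia]. }
    destruct (Hk (n a)) as [k Hk']. apply Hz. exists (S k). right. exists a. split; [reflexivity|exact Hk'].
Qed.

(** The operator without extension has coordinates indexed by an ordinal and a length, so the pairs
    need the order type omega_1. An initial segment of pairs lies over a countable closed
    segment. *)
Lemma omega1_times_nat : is_omega1 (Relation_Operators.slexprod Z nat ltZ Peano.lt).
Proof.
  pose proof HZ as (Hwf & Htr & Htri & Hunc & Hseg).
  split; [|split; [|split; [|split]]].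
  - apply wf_slexprod; [exact Hwf|exact Nat.lt_wf_0].
  - intros x y z H1 H2. destruct H1; inversion H2; subst;
      constructor; solve [assumption|eapply Htr; eassumption|lia].
  - intros [x m] [y n]. destruct (Htri x y) as [H|[->|H]].
    + left; constructor; exact H.
    + destruct (Nat.lt_trichotomy m n) as [H|[->|H]]; [left|right; left|right; right];
        try constructor; assumption.
    + right; right; constructor; exact H.
  - intros [f Hf]. apply Hunc. exists (fun z => f (z, O)). intros x y H. apply Hf in H. congruence.
  - intros [z n].
    destruct (countable_set_bigunion (fun y => ltZ y z \/ y = z) (fun y (p : Z * nat) => fst p = y)
      (omega1_closed_segment z)) as [f Hf].
    + intros y _. exists snd. intros [x1 m1] [x2 m2]; simpl; intros; congruence.
    + exists f. intros p q Hp Hq. apply Hf.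
      * exists (fst p). split; [inversion Hp; simpl; auto|reflexivity].
      * exists (fst q). split; [inversion Hq; simpl; auto|reflexivity].
Qed.

End Omega1.

(** [Z] consists of the points with countably many predecessors in a well-order of [X]. If it were
    countable, well-founded induction would put every point of [X] into it, and [X] would be
    countable. *)
Lemma omega1_embeds (X : Type) : uncountable X ->
  exists (Z : Type) (ltZ : Z -> Z -> Prop) (i : Z -> X),
    is_omega1 ltZ /\ forall x y, i x = i y -> x = y.
Proof.
  intros HX. destruct (well_order_exists X) as (ltX & Hwf & Htr & Htri).
  set (Z := {x | countable_set (fun y => ltX y x)}). set (i := fun z : Z => proj1_sig z).
  assert (Hi : forall x y, i x = i y -> x = y).
  { intros [x Hx] [y Hy] H. apply subset_eq_compat. exact H. }
  exists Z, (fun x y => ltX (i x) (i y)), i. split; [|exact Hi].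
  split; [|split; [|split; [|split]]].
  - apply wf_inverse_image, Hwf.
  - intros x y z; apply Htr.
  - intros x y. destruct (Htri (i x) (i y)) as [H|[H|H]]; auto.
  - intros [f Hf].
    assert (HZ : countable_set (fun x => countable_set (fun y => ltX y x))).
    { apply (countable_set_sub _ (fun x => exists z : Z, True /\ i z = x)).
      - intros x Hx. exists (exist _ x Hx). auto.
      - apply countable_set_image. exists f. intros x y _ _; apply Hf. }
    assert (Hall : forall x, countable_set (fun y => ltX y x)).
    { intros x. induction x as [x IH] using (well_founded_induction Hwf).
      revert HZ. apply countable_set_sub. exact IH. }
    apply HX. destruct HZ as [g Hg]. exists g. intros x y; apply Hg; apply Hall.
  - intros z. destruct (proj2_sig z) as [f Hf]. exists (fun y => f (i y)).
    intros x y Hx Hy E. apply Hi, Hf; assumption.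
Qed.

(** * The two extension properties *)

Lemma cont_subspace {X} {le : X -> X -> Prop} : total_order le -> subspace (cont_real le).
Proof. intros Hle. split; [apply cont_real_const|]. intros; apply cont_real_lin; assumption. Qed.

Lemma pad_agree {L} (c : L) k x y : agree k x y -> pad c k x = pad c k y.
Proof.
  intros H. apply functional_extensionality; intros m. unfold pad.
  destruct (Nat.ltb_spec m k); auto.
Qed.

Lemma ForallOrdPairs_impl {X} (P Q : X -> X -> Prop) l :
  (forall x y, P x y -> Q x y) -> ForallOrdPairs P l -> ForallOrdPairs Q l.
Proof.
  intros H Hl. induction Hl as [|x l Hx Hl IH]; constructor; [|exact IH].
  revert Hx. apply Forall_impl. auto.
Qed.

Lemma sum_list_single {I} (h : I -> R) b l :
  NoDup l -> In b l -> (forall a, a <> b -> h a = 0) -> sum_list h l = h b.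
Proof.
  intros Hl Hb Hh. induction Hl as [|a l Ha Hl IH]; [destruct Hb|]. simpl.
  destruct Hb as [->|Hb].
  - rewrite (sum_list_ext h (fun _ => 0)), sum_list_const; [lra|].
    intros i Hi. apply Hh. intros ->; contradiction.
  - rewrite (IH Hb), Hh; [lra|]. intros ->; contradiction.
Qed.

(** [d n] is the largest [k] up to [n] with [G k n]. The cap [n] makes a largest one exist, and
    [G O n] makes the set nonempty. *)
Lemma eventually_diagonal (G : nat -> nat -> Prop) :
  (forall n, G O n) -> (forall k, exists N, forall n, (N <= n)%nat -> G k n) ->
  exists d : nat -> nat, (forall n, G (d n) n) /\
    forall k, exists N, forall n, (N <= n)%nat -> (k <= d n)%nat.
Proof.
  intros G0 HG.
  assert (H : forall n, exists d, G d n /\ forall k, (k <= n)%nat -> G k n -> (k <= d)%nat).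
  { intros n.
    enough (forall N, exists d, G d n /\ forall k, (k <= N)%nat -> G k n -> (k <= d)%nat) by auto.
    induction N as [|N (d & Hd & IH)]; [exists O; split; [auto|lia]|].
    destruct (classic (G (S N) n)) as [H|H].
    - exists (S N). split; [exact H|lia].
    - exists d. split; [exact Hd|]. intros k Hk Gk.
      destruct (Nat.eq_dec k (S N)) as [->|Hne]; [contradiction|]. apply IH; [lia|exact Gk]. }
  destruct (choice _ H) as [d Hd]. exists d. split; [intros n; apply Hd|].
  intros k. destruct (HG k) as [N HN]. exists (max N k). intros n Hn.
  apply (Hd n); [lia|]. apply HN; lia.
Qed.

Definition null_seq (a : nat -> R) :=
  forall eps, 0 < eps -> exists N, forall n, (N <= n)%nat -> Rabs (a n) < eps.

Lemma in_c0_nat (a : nat -> R) : in_c0 a <-> null_seq a.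
Proof.
  split; intros Ha eps Heps; destruct (Ha eps Heps) as [s Hs].
  - exists (S (list_max s)). intros n Hn. apply Rnot_le_lt. intros H.
    pose proof (proj1 (list_max_le s (list_max s)) (le_n _)) as Hmax.
    rewrite Forall_forall in Hmax. specialize (Hmax n (Hs n H)). lia.
  - exists (seq 0 s). intros n Hn. apply in_seq. split; [lia|].
    destruct (Nat.lt_ge_cases n s) as [H|H]; [lia|]. specialize (Hs n H). lra.
Qed.

Lemma null_seq_lin a b (u v : nat -> R) :
  null_seq u -> null_seq v -> null_seq (fun n => a * u n + b * v n).
Proof.
  intros Hu Hv eps Heps.
  destruct (small_multiple eps a Heps) as (da & Hda & Ha).
  destruct (small_multiple eps b Heps) as (db & Hdb & Hb).
  destruct (Hu _ Hda) as [N1 H1]. destruct (Hv _ Hdb) as [N2 H2].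
  exists (max N1 N2). intros n Hn. specialize (H1 n ltac:(lia)). specialize (H2 n ltac:(lia)).
  eapply Rle_lt_trans; [apply Rabs_triang|]. rewrite !Rabs_mult.
  pose proof (Rmult_le_compat_l _ _ _ (Rabs_pos a) (Rlt_le _ _ H1)).
  pose proof (Rmult_le_compat_l _ _ _ (Rabs_pos b) (Rlt_le _ _ H2)). lra.
Qed.

Lemma null_seq_ext (u v : nat -> R) : (forall n, u n = v n) -> null_seq u -> null_seq v.
Proof.
  intros E Hu eps Heps. destruct (Hu eps Heps) as [N HN]. exists N. intros n Hn.
  rewrite <- E. auto.
Qed.

(** * Cuts and bumps on the split power *)

Section SplitLexicographic.
Context {L : Type} (leL : L -> L -> Prop) (Hcl : complete_line leL).
Context (bot top : L) (Hbot : forall x, leL bot x) (Htop : forall x, leL x top)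
  (Hne : bot <> top).
Context {A : Type} (t : A -> nat -> L) (Ht : forall a b, t a = t b -> a = b).

Notation K := (nat -> L).
Notation leK := (lex leL).
Notation Q := (fun x => exists a, t a = x).
Notation Kt := (split_line Q).
Notation leKt := (split_le leK Q).
Notation pr := (proj Q).
Notation lw := (low Q).

Let HK : complete_line leK := lex_complete leL Hcl.
Let HKt : complete_line leKt := split_complete leK HK Q.

Definition cut (a : A) : Kt -> R := step_le leKt (lw (t a)).

Definition upper (a : A) : Kt := high Q (t a) (ex_intro _ a eq_refl).

Lemma cont_cut a : cont_real leKt (cut a).
Proof. apply (cont_step_le _ (upper a) (proj1 HKt)), low_adjacent, HK. Qed.

Lemma cont_pullback f : cont_real leK f -> cont_real leKt (fun z => f (pr z)).
Proof. intros Hf V HV. exact (proj_continuous leK HK Q _ (Hf V HV)). Qed.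

(** One minus a ramp across the node, whose ends differ because [bot] and [top] do. *)
Lemma fall_exists (p : K * nat) : exists f : K -> R, cont_real leK f /\
  (forall x, 0 <= f x <= 1) /\
  (forall x, leK x (pad bot (snd p) (fst p)) -> f x = 1) /\
  (forall x, leK (pad top (snd p) (fst p)) x -> f x = 0).
Proof.
  destruct (ordered_urysohn (proj1 HK) _ _ (pad_lt leL bot top Hbot (snd p) (fst p) Hne))
    as (r & Hr & R01 & R0 & R1).
  exists (fun x => 1 * 1 + (-1) * r x). split; [|split; [|split]].
  - apply (cont_real_lin (proj1 HK)); [apply cont_real_const|exact Hr].
  - intros x. specialize (R01 x). lra.
  - intros x Hx. rewrite (R0 x Hx). lra.
  - intros x Hx. rewrite (R1 x Hx). lra.
Qed.

Definition fall (x : K) (k : nat) : K -> R :=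
  proj1_sig (constructive_indefinite_description _ (fall_exists (x, k))).

Lemma fall_spec x k : cont_real leK (fall x k) /\
  (forall y, 0 <= fall x k y <= 1) /\
  (forall y, leK y (pad bot k x) -> fall x k y = 1) /\
  (forall y, leK (pad top k x) y -> fall x k y = 0).
Proof. unfold fall. destruct constructive_indefinite_description as [f Hf]. exact Hf. Qed.

(** The explicit coefficients match the linearity clause of the functionals. *)
Definition local_cut (a : A) (k : nat) : Kt -> R :=
  fun z => 1 * cut a z + (-1) * fall (t a) k (pr z).

Lemma cont_local_cut a k : cont_real leKt (local_cut a k).
Proof.
  apply (cont_real_lin (proj1 HKt)); [apply cont_cut|apply cont_pullback, fall_spec].
Qed.

Lemma local_cut_bound a k z : Rabs (local_cut a k z) <= 1.
Proof.
  unfold local_cut. pose proof (step_le_range leKt (lw (t a)) z).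
  destruct (fall_spec (t a) k) as (_ & H1 & _). specialize (H1 (pr z)).
  fold (cut a) in *. unfold cut in *. apply Rabs_le; lra.
Qed.

(** To the left of the node the cut and the fall are both 1, to the right both are 0. *)
Lemma local_cut_support a k z : local_cut a k z <> 0 -> agree k (t a) (pr z).
Proof.
  intros H. destruct (fall_spec (t a) k) as (_ & _ & H1 & H0).
  pose proof (proj1 HK) as HleK.
  destruct (proj1 (agree_iff_between leL Hcl bot top Hbot Htop k (t a) (t a)) (fun m _ => eq_refl))
    as [Hb Ht'].
  apply (agree_iff_between leL Hcl bot top Hbot Htop). split.
  - destruct (le_lt_cases HleK (pad bot k (t a)) (pr z)) as [Hz|Hz]; [exact Hz|].
    exfalso; apply H. unfold local_cut, cut. rewrite (H1 _ (proj1 Hz)), step_le_1; [lra|].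
    apply (proj_lt leK Q). exact (lt_le_trans HleK _ _ _ Hz Hb).
  - destruct (le_lt_cases HleK (pr z) (pad top k (t a))) as [Hz|Hz]; [exact Hz|].
    exfalso; apply H. unfold local_cut, cut. rewrite (H0 _ (proj1 Hz)), step_le_0; [lra|].
    apply (lt_not_le (proj1 HKt)), (proj_lt leK Q). exact (le_lt_trans HleK _ _ _ Ht' Hz).
Qed.

Notation separated m l := (ForallOrdPairs (fun a b => ~ agree m (t a) (t b)) l).

(** Different nodes of the same length are disjoint, so at most one summand is nonzero at any
    point. *)
Lemma sum_node_supported (v : A -> Kt -> R) m l :
  separated m l -> (forall a z, In a l -> Rabs (v a z) <= 1) ->
  (forall a z, In a l -> v a z <> 0 -> agree m (t a) (pr z)) ->
  forall z, sum_list (fun a => Rabs (v a z)) l <= 1.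
Proof.
  intros Hl Hv Hs z.
  assert (H : forall a, In a l -> Rabs (v a z) <= 1) by auto.
  assert (Hs' : forall a, In a l -> v a z <> 0 -> agree m (t a) (pr z)) by auto.
  clear Hv Hs. induction Hl as [|a l Ha Hl IH]; simpl; [lra|].
  destruct (Req_dec (v a z) 0) as [Hz|Hnz].
  - rewrite Hz, Rabs_R0, Rplus_0_l. apply IH; intros; [apply H|apply Hs']; simpl; auto.
  - rewrite (sum_list_ext _ (fun _ => 0)), sum_list_const.
    + specialize (H a (or_introl eq_refl)). lra.
    + intros b Hb. rewrite Forall_forall in Ha. destruct (Req_dec (v b z) 0) as [E|E];
        [rewrite E; apply Rabs_R0|]. exfalso. apply (Ha b Hb).
      eapply agree_trans; [apply Hs'; [left; reflexivity|exact Hnz]|].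
      apply agree_sym, Hs'; [right; exact Hb|exact E].
Qed.

(** The first differences within a finite list are bounded. The lower bound [k] serves to keep the
    separating nodes inside a given node of length [k]. *)
Lemma separation_level l k : NoDup l -> exists m, (k <= m)%nat /\ separated m l.
Proof.
  intros Hl. induction Hl as [|a l Ha Hl [m [Hkm IH]]]; [exists k; split; [lia|constructor]|].
  assert (exists m', forall b, In b l -> ~ agree m' (t a) (t b)) as [m' Hm'].
  { clear Hl IH. induction l as [|b l IHl]; [exists O; intros b []|].
    destruct IHl as [m1 H1]; [intros H; apply Ha; right; exact H|].
    destruct (first_difference (t a) (t b)) as (n & _ & Hn).
    { intros E. apply Ht in E. apply Ha; left; congruence. }
    exists (max m1 (S n)). intros c [<-|Hc] Hag.
    - apply Hn, Hag; lia.
    - apply (H1 c Hc), (agree_weaken (max m1 (S n))); [lia|exact Hag]. }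
  exists (max m m'). split; [lia|]. constructor.
  - apply Forall_forall. intros b Hb Hag. apply (Hm' b Hb), (agree_weaken (max m m')); [lia|exact Hag].
  - revert IH. apply ForallOrdPairs_impl. intros x y H Hag. apply H.
    apply (agree_weaken (max m m')); [lia|exact Hag].
Qed.

(** * Failure of the extension property for omega_1 *)

Section NoExtension.
Context (HA : inhabited A).
Hypothesis Hbig : forall n : A -> nat, exists a0,
  ~ countable_set (fun a => n a = n a0 /\ agree (n a0) (t a) (t a0)).
Context {I : Type} (j : A * nat -> I) (Hj : forall p q, j p = j q -> p = q).

Lemma node_osc_small (f : K -> R) eps x : cont_real leK f -> 0 < eps ->
  exists N, forall k, (N <= k)%nat -> Rabs (f (pad top k x) - f (pad bot k x)) < eps.
Proof.
  intros Hf Heps. destruct (proj1 (cont_real_iff f) Hf x (eps/2) ltac:(lra)) as (lo & hi & H1 & H2).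
  destruct (lex_nbhd leL lo hi x H1) as [N HN]. exists N. intros k Hk.
  assert (H : forall c, Rabs (f (pad c k x) - f x) < eps / 2).
  { intros c. apply H2, HN, (agree_weaken k); [exact Hk|apply agree_pad]. }
  pose proof (H top) as H3. pose proof (H bot) as H4.
  apply Rabs_def2 in H3. apply Rabs_def2 in H4. apply Rabs_def1; lra.
Qed.

(* Locally, a node on which [f] oscillates must contain an endpoint of a small
   interval, hence is one of finitely many nodes around that endpoint. *)
Lemma node_osc_locally_finite (f : K -> R) eps c : cont_real leK f -> 0 < eps ->
  exists lo hi (l : list (K * nat)), oint leK lo hi c /\ forall x k y,
    oint leK lo hi y -> agree k x y ->
    eps <= Rabs (f (pad top k x) - f (pad bot k x)) ->
    exists z, In (z, k) l /\ agree k x z.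
Proof.
  intros Hf Heps. pose proof (proj1 HK) as Hle.
  destruct (proj1 (cont_real_iff f) Hf c (eps/2) ltac:(lra)) as (lo & hi & H1 & H2).
  assert (Hend : forall e : option K, exists l : list (K * nat), forall z k x, e = Some z ->
    agree k x z -> eps <= Rabs (f (pad top k x) - f (pad bot k x)) -> In (z, k) l).
  { intros [z|]; [|exists nil; discriminate]. destruct (node_osc_small f eps z Hf Heps) as [N HN].
    exists (map (fun k => (z, k)) (seq 0 N)). intros z' k x E Hx Hosc. injection E as <-.
    apply (in_map (fun k => (z, k))), in_seq. split; [lia|].
    destruct (Nat.lt_ge_cases k N) as [H|H]; [lia|exfalso].
    rewrite !(pad_agree _ k x z Hx) in Hosc. specialize (HN k H). lra. }
  destruct (Hend lo) as [l1 Hl1]. destruct (Hend hi) as [l2 Hl2].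
  exists lo, hi, (l1 ++ l2). split; [exact H1|]. intros x k y Hy Hxy Hosc.
  assert (Hag : forall z, leK (pad bot k x) z -> leK z (pad top k x) -> agree k x z)
    by (intros; apply (agree_iff_between leL Hcl bot top Hbot Htop); auto).
  apply (agree_iff_between leL Hcl bot top Hbot Htop) in Hxy. destruct Hxy as [Hy1 Hy2].
  (* If both ends of the node lie in the interval, their values are within [eps / 2] of [f c].
     Otherwise the node, which meets the interval in [y], contains one of its ends. *)
  destruct (classic (oint leK lo hi (pad bot k x))) as [Hb|Hb].
  - destruct (classic (oint leK lo hi (pad top k x))) as [Ht'|Ht'].
    + exfalso. pose proof (H2 _ Hb) as H3. pose proof (H2 _ Ht') as H4.
      apply Rabs_def2 in H3. apply Rabs_def2 in H4. revert Hosc. apply Rlt_not_le, Rabs_def1; lra.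
    + destruct hi as [h|].
      * exists h. assert (Hh : agree k x h).
        { destruct Hy as [_ Hy]. apply Hag; [exact (proj1 (le_lt_trans Hle _ _ _ Hy1 Hy))|].
          destruct (le_lt_cases Hle h (pad top k x)) as [H|H]; [exact H|]. exfalso; apply Ht'.
          split; [|exact H]. destruct lo as [a|]; [|exact Logic.I]. destruct Hb as [Hb _].
          exact (lt_le_trans Hle _ _ _ Hb (proj1 (pad_lt leL bot top Hbot k x Hne))). }
        split; [|exact Hh]. apply in_or_app; right. eapply Hl2; eauto.
      * exfalso; apply Ht'. split; [|exact Logic.I]. destruct lo as [a|]; [|exact Logic.I].
        destruct Hb as [Hb _].
        exact (lt_le_trans Hle _ _ _ Hb (proj1 (pad_lt leL bot top Hbot k x Hne))).
  - destruct lo as [a|].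
    + destruct (le_lt_cases Hle (pad bot k x) a) as [H|H].
      * exists a. assert (Ha : agree k x a).
        { destruct Hy as [Hy _]. apply Hag; [exact H|]. exact (proj1 (lt_le_trans Hle _ _ _ Hy Hy2)). }
        split; [|exact Ha]. apply in_or_app; left. eapply Hl1; eauto.
      * exfalso; apply Hb. split; [exact H|]. destruct hi as [h|]; [|exact Logic.I].
        destruct Hy as [_ Hy]. exact (le_lt_trans Hle _ _ _ Hy1 Hy).
    + exfalso; apply Hb. split; [exact Logic.I|]. destruct hi as [h|]; [|exact Logic.I].
      destruct Hy as [_ Hy]. exact (le_lt_trans Hle _ _ _ Hy1 Hy).
Qed.

(** Compactness passes from local to global finiteness, since each node contains its own [x]. This
    is what puts the jumps of a continuous function on [K] into [c_0]. *)
Lemma node_osc_finite (f : K -> R) eps : cont_real leK f -> 0 < eps ->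
  exists l : list (K * nat), forall x k,
    eps <= Rabs (f (pad top k x) - f (pad bot k x)) -> exists z, In (z, k) l /\ agree k x z.
Proof.
  intros Hf Heps.
  destruct (choice (fun c (d : option K * option K * list (K * nat)) =>
    oint leK (fst (fst d)) (snd (fst d)) c /\ forall x k y,
    oint leK (fst (fst d)) (snd (fst d)) y -> agree k x y ->
    eps <= Rabs (f (pad top k x) - f (pad bot k x)) ->
    exists z, In (z, k) (snd d) /\ agree k x z)) as [d Hd].
  { intros c. destruct (node_osc_locally_finite f eps c Hf Heps) as (lo & hi & l & H).
    exists (lo, hi, l). exact H. }
  destruct (proj2 (complete_line_compact HK) K
    (fun c => oint leK (fst (fst (d c))) (snd (fst (d c))))) as [s Hs].
  - intros c x Hx. eauto.
  - intros x. exists x. apply Hd.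
  - exists (flat_map (fun c => snd (d c)) s). intros x k Hosc.
    destruct (Hs x) as (c & Hc & Hx).
    destruct (proj2 (Hd c) x k x Hx (fun m _ => eq_refl) Hosc) as (z & Hz & Hag).
    exists z; split; [|exact Hag]. apply in_flat_map. eauto.
Qed.

(** A canonical index for each node. With one coordinate for every pair [(a, k)], a node shared by
    infinitely many [t a] would repeat its jump infinitely often and leave [c_0]. *)
Definition rep (k : nat) (a : A) : A := epsilon HA (fun b => agree k (t b) (t a)).

Lemma rep_agree k a : agree k (t (rep k a)) (t a).
Proof. apply (epsilon_spec HA (fun b => agree k (t b) (t a))). exists a. intros m _; reflexivity. Qed.

Lemma rep_eq k a b : agree k (t a) (t b) -> rep k a = rep k b.
Proof.
  intros H. unfold rep. f_equal. apply functional_extensionality; intros c.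
  apply propositional_extensionality. split; intros H'; eapply agree_trans; eauto using agree_sym.
Qed.

(* One coordinate per node; a node is represented by a pair [(a, k)] with
   [rep k a = a], and the other coordinates vanish. *)
Definition node_jump (g : Kt -> R) (i : I) : R :=
  match excluded_middle_informative (exists p, j p = i /\ rep (snd p) (fst p) = fst p) with
  | left H => let p := proj1_sig (constructive_indefinite_description _ H) in
      g (lw (pad top (snd p) (t (fst p)))) - g (lw (pad bot (snd p) (t (fst p))))
  | right _ => 0
  end.

Lemma node_jump_val g a k : rep k a = a ->
  node_jump g (j (a, k)) = g (lw (pad top k (t a))) - g (lw (pad bot k (t a))).
Proof.
  intros Ha. unfold node_jump. destruct excluded_middle_informative as [H|H].
  - destruct constructive_indefinite_description as [p [Hp Hr]]; simpl.
    apply Hj in Hp. subst p. reflexivity.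
  - exfalso; apply H. exists (a, k); auto.
Qed.

Lemma node_jump_cases g i :
  (exists a k, i = j (a, k) /\ rep k a = a) \/ node_jump g i = 0.
Proof.
  unfold node_jump. destruct excluded_middle_informative as [([a k] & H & H')|H]; [left|right; reflexivity].
  exists a, k; auto.
Qed.

Lemma node_jump_op : bdd_lin_op_c0
  (fun g => exists f, cont_real leK f /\ forall x, g x = f (pr x)) node_jump.
Proof.
  split; [|split].
  - intros g h a b _ _ i. unfold node_jump. destruct excluded_middle_informative; simpl; ring.
  - exists 2. intros g _ Hg i. unfold node_jump. destruct excluded_middle_informative as [H|H].
    + destruct constructive_indefinite_description as [p Hp]; simpl.
      pose proof (Hg (lw (pad top (snd p) (t (fst p))))) as H1.
      pose proof (Hg (lw (pad bot (snd p) (t (fst p))))) as H2.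
      unfold Rminus. eapply Rle_trans; [apply Rabs_triang|]. rewrite Rabs_Ropp. lra.
    + rewrite Rabs_R0; lra.
  - intros g (f & Hf & Hgf) eps Heps. destruct (node_osc_finite f eps Hf Heps) as [l Hl].
    (* Each listed node carries at most one coordinate, that of its representative. *)
    exists (map (fun p => j (epsilon HA (fun a => agree (snd p) (t a) (fst p) /\ rep (snd p) a = a), snd p)) l).
    intros i Hi. destruct (node_jump_cases g i) as [(a & k & -> & Ha)|H0].
    + rewrite node_jump_val, !Hgf in Hi by exact Ha. destruct (Hl _ _ Hi) as (z & Hz & Hag).
      apply in_map_iff. exists (z, k). split; [|exact Hz]. simpl. f_equal. f_equal.
      pose proof (epsilon_spec HA (fun a => agree k (t a) z /\ rep k a = a)
        (ex_intro _ a (conj Hag Ha))) as [H1 H2].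
      rewrite <- H2, <- Ha. apply rep_eq. eapply agree_trans; [exact H1|apply agree_sym, Hag].
    + rewrite H0, Rabs_R0 in Hi. lra.
Qed.

(** This turns membership in [c_0] into a length from which on all coordinates are small. *)
Lemma level_bound (s : list I) : exists N, forall a k, In (j (a, k)) s -> (k < N)%nat.
Proof.
  induction s as [|i s [N IH]]; [exists O; intros a k []|].
  destruct (classic (exists a k, j (a, k) = i)) as [(a0 & k0 & E)|Hn].
  - exists (max N (S k0)). intros a k [H|H].
    + rewrite <- E in H. apply Hj in H. injection H as _ ->. lia.
    + specialize (IH a k H). lia.
  - exists N. intros a k [H|H]; [exfalso; eauto|eauto].
Qed.

(** At the common node of length [n0] the extension is below 1/4 in absolute value on each cut and
    equals -1 on each fall, hence exceeds 3/4 on each bump. More than [M / (3/4)] disjoint bumps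
    contradict the bound [M]. *)
Lemma no_c0_extension : ~ c0I_ext_property leKt leK pr I.
Proof.
  intros Hext. destruct (Hext node_jump node_jump_op) as (E & (Elin & [M EM] & Ec0) & Eext).
  destruct (choice (fun (a : A) N => forall b k, (N <= k)%nat -> Rabs (E (cut a) (j (b, k))) < 1/4))
    as [n Hn].
  { intros a. destruct (Ec0 _ (cont_cut a) (1/4) ltac:(lra)) as [s Hs].
    destruct (level_bound s) as [N HN]. exists N. intros b k Hk. apply Rnot_le_lt. intros H.
    specialize (HN b k (Hs _ H)). lia. }
  destruct (Hbig n) as [a0 Ha0]. set (n0 := n a0) in *.
  set (b := rep n0 a0). assert (Hb : rep n0 b = b) by apply rep_eq, rep_agree.
  set (e := fun g => E g (j (b, n0))).
  assert (He : bounded_on (cont_real leKt) e M).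
  { split; [intros; apply Elin; assumption|]. intros; apply EM; assumption. }
  pose proof (cont_subspace (proj1 HKt)) as HD.
  destruct (INR_unbounded (M / (3/4))) as [N HN].
  destruct (not_countable_arbitrarily_long _ Ha0 N) as (l & Hlen & Hl & Hnd).
  destruct (separation_level l n0 Hnd) as (m & Hm & Hsep).
  assert (Hsum : sum_list (fun a => Rabs (e (local_cut a m))) l <= M).
  { apply (sum_abs_le (cont_real leKt) e M HD He); [intros; apply cont_local_cut|].
    apply (sum_node_supported (fun a => local_cut a m) m l Hsep);
      intros; [apply local_cut_bound|apply local_cut_support; assumption]. }
  assert (Hlow : sum_list (fun _ => 3/4) l <= sum_list (fun a => Rabs (e (local_cut a m))) l).
  { apply sum_list_le. intros a Hal. destruct (Hl a Hal) as [Ena Haa].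
    destruct (fall_spec (t a) m) as (Hfc & _ & Hf1 & Hf0).
    unfold local_cut. rewrite (proj1 He) by (apply cont_cut || apply cont_pullback, Hfc).
    assert (Hag : agree n0 (t b) (t a)).
    { eapply agree_trans; [apply rep_agree|apply agree_sym, Haa]. }
    (* As [n0 <= m], the fall takes place inside the node of length [n0]: it is 1 at the left end of
       that node and 0 at the right end. *)
    assert (HT : e (fun z => fall (t a) m (pr z)) = -1).
    { unfold e. rewrite Eext by (exists (fall (t a) m); auto). rewrite node_jump_val by exact Hb.
      change (fall (t a) m (pad top n0 (t b)) - fall (t a) m (pad bot n0 (t b)) = -1).
      rewrite !(pad_agree _ n0 _ _ Hag).
      assert (H : forall c, agree n0 (t a) (pad c m (t a))).
      { intros c. apply (agree_weaken m); [exact Hm|apply agree_pad]. }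
      rewrite Hf0, Hf1; [lra| |]; apply (agree_iff_between leL Hcl bot top Hbot Htop), H. }
    rewrite HT. pose proof (Hn a b n0 ltac:(rewrite Ena; apply le_n)) as H.
    apply Rabs_def2 in H. fold (e (cut a)) in H. rewrite Rabs_pos_eq; lra. }
  rewrite sum_list_const, Hlen in Hlow.
  assert (M < INR N * (3/4)); [|lra].
  apply (Rmult_lt_compat_r (3/4)) in HN; [|lra].
  replace (M / (3/4) * (3/4)) with M in HN by field. exact HN.
Qed.

End NoExtension.

(** * The extension property for sequences *)

Section SequenceExtension.
Hypothesis Hsmall : forall S : A -> Prop, countable_set S ->
  countable_set (fun a => forall k, exists s, S s /\ t a k = t s k).

Notation V := (fun g : Kt -> R => exists f, cont_real leK f /\ forall z, g z = f (pr z)).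

Definition node_bounded (a : A) (k : nat) (v : Kt -> R) :=
  (forall z, Rabs (v z) <= 1) /\ forall z, v z <> 0 -> agree k (t a) (pr z).

(** More than [M / eps] different nodes of length [k], each with a function on which [e] exceeds
    [eps], would contradict the bound [M]. *)
Lemma charged_nodes_finite (e : (Kt -> R) -> R) M k eps :
  bounded_on bounded_fun e M -> 0 < eps ->
  exists l, forall a v, node_bounded a k v -> eps < Rabs (e v) ->
    exists b, In b l /\ agree k (t a) (t b).
Proof.
  intros He Heps.
  destruct (net_or_separated (fun a => exists v, node_bounded a k v /\ eps < Rabs (e v))
    (fun a b => agree k (t a) (t b))) as [(l & _ & Hl)|Hsep].
  { exists l. intros a v Hv Hev. apply Hl; eauto. }
  exfalso. destruct (INR_unbounded (M / eps)) as [N HN].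
  destruct (Hsep N) as (l & Hlen & Hl & Hls).
  destruct (choice (fun a v => In a l -> node_bounded a k v /\ eps < Rabs (e v))) as [v Hv].
  { intros a. destruct (classic (In a l)) as [H|H]; [|exists (fun _ => 0); tauto].
    destruct (Hl a H) as [v Hv]. exists v; auto. }
  assert (Hsum : sum_list (fun a => Rabs (e (v a))) l <= M).
  { apply (sum_abs_le bounded_fun e M subspace_bounded He).
    - intros a Ha. exists 1. apply (Hv a Ha).
    - apply (sum_node_supported v k l Hls); intros a z Ha; apply (Hv a Ha). }
  assert (Hlow : sum_list (fun _ => eps) l <= sum_list (fun a => Rabs (e (v a))) l).
  { apply sum_list_le. intros a Ha. destruct (Hv a Ha). lra. }
  rewrite sum_list_const, Hlen in Hlow.
  apply (Rmult_lt_compat_r eps) in HN; [|exact Heps].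
  replace (M / eps * eps) with M in HN by (field; lra). lra.
Qed.

(** Finite nets for all functionals, lengths and thresholds [/ INR q] give a countable set of
    indices. The length is [S k] because agreement on that many letters includes letter [k], as
    [Hsmall] requires. *)
Lemma charged_branches_countable (e : nat -> (Kt -> R) -> R) M :
  (forall n, bounded_on bounded_fun (e n) M) ->
  countable_set (fun a => forall k, exists n v, node_bounded a (S k) v /\ e n v <> 0).
Proof.
  intros He.
  destruct (choice (fun (p : nat * nat * nat) l => (0 < snd p)%nat ->
    forall a v, node_bounded a (S (snd (fst p))) v -> / INR (snd p) < Rabs (e (fst (fst p)) v) ->
    exists b, In b l /\ agree (S (snd (fst p))) (t a) (t b))) as [net Hnet].
  { intros [[n k] q]; simpl. destruct q as [|q]; [exists nil; lia|].
    destruct (charged_nodes_finite (e n) M (S k) (/ INR (S q)) (He n)) as [l Hl].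
    - apply Rinv_0_lt_compat, lt_0_INR; lia.
    - exists l. intros _. exact Hl. }
  assert (HS : countable_set (fun b => exists n k q, In b (net (n, k, q)))).
  { apply countable_set_union; intros n. apply countable_set_union; intros k.
    apply countable_set_union; intros q. apply countable_set_list. }
  apply Hsmall in HS. revert HS. apply countable_set_sub. intros a Ha k.
  destruct (Ha k) as (n & v & Hv & Hne').
  destruct (archimed_cor1 (Rabs (e n v))) as (q & Hq & Hq0); [apply Rabs_pos_lt, Hne'|].
  destruct (Hnet (n, k, q) Hq0 a v Hv Hq) as (b & Hb & Hag).
  exists b. split; [eauto|]. apply Hag. simpl; lia.
Qed.

(** It annihilates the pullbacks and is biorthogonal to the cuts, so it changes a functional at one
    cut without touching its restriction to [C(K)]. *)
Definition jump (a : A) (g : Kt -> R) := g (lw (t a)) - g (upper a).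

Lemma jump_pullback a f : jump a (fun z => f (pr z)) = 0.
Proof. unfold jump. change (f (t a) - f (t a) = 0). ring. Qed.

Lemma jump_cut_same a : jump a (cut a) = 1.
Proof.
  unfold jump, cut. rewrite step_le_1, step_le_0; [ring| |].
  - apply (lt_not_le (proj1 HKt)). apply low_adjacent, HK.
  - apply (proj1 (proj1 HKt)).
Qed.

Lemma jump_cut_other a b : a <> b -> jump a (cut b) = 0.
Proof.
  intros Hab. assert (Hd : t a <> t b) by (intros E; apply Ht in E; contradiction).
  unfold jump, cut. destruct (le_lt_cases (proj1 HK) (t a) (t b)) as [H|H].
  - rewrite !step_le_1; [ring| |]; apply (proj_lt leK Q); split; assumption.
  - rewrite !step_le_0; [ring| |]; apply (lt_not_le (proj1 HKt)), (proj_lt leK Q); exact H.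
Qed.

Lemma jump_bound a g c : (forall z, Rabs (g z) <= c) -> Rabs (jump a g) <= 2 * c.
Proof.
  intros H. unfold jump, Rminus. eapply Rle_trans; [apply Rabs_triang|]. rewrite Rabs_Ropp.
  pose proof (H (lw (t a))). pose proof (H (upper a)). lra.
Qed.

(** Points with different projections are separated by a ramp on [K], the two copies of one point by
    its cut; these ramps feed the density argument. *)
Lemma pullback_or_cut_ramp p q : lt leKt p q ->
  (exists r, cont_real leK r /\ ramp leKt p q (fun z => r (pr z))) \/
  exists a, ramp leKt p q (fun z => 1 * 1 + (-1) * cut a z).
Proof.
  intros Hpq. destruct (split_lt_cases leK Q p q Hpq) as [H|(x & [a <-] & -> & ->)].
  - left. destruct (ordered_urysohn (proj1 HK) _ _ H) as (r & Hr & R01 & R0 & R1).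
    exists r. split; [exact Hr|]. split; [intros; apply R01|split].
    + intros z Hz. apply R0, (proj_increasing leK HK Q), Hz.
    + intros z Hz. apply R1, (proj_increasing leK HK Q), Hz.
  - right. exists a. split; [|split]; intros z.
    + pose proof (step_le_range leKt (lw (t a)) z). unfold cut. lra.
    + intros Hz. unfold cut. rewrite step_le_1 by exact Hz. ring.
    + intros Hz. unfold cut. rewrite step_le_0; [ring|]. apply (lt_not_le (proj1 HKt)).
      exact (lt_le_trans (proj1 HKt) _ _ _ Hpq Hz).
Qed.
(* Works because the pullbacks and the cuts span a dense subspace of [C(Kt)]. *)
Lemma null_on_generators (E : nat -> (Kt -> R) -> R) M :
  (forall n, bounded_on (cont_real leKt) (E n) M) ->
  (forall f, cont_real leK f -> null_seq (fun n => E n (fun z => f (pr z)))) ->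
  (forall a, null_seq (fun n => E n (cut a))) ->
  forall g, cont_real leKt g -> null_seq (fun n => E n g).
Proof.
  intros HE HV Hcut g Hg eps Heps.
  pose proof (cont_subspace (proj1 HKt)) as HD.
  pose proof (bounded_on_nonneg _ _ _ HD (HE O)) as HM.
  assert (H1 : cont_real leKt (fun _ => 1)) by apply cont_real_const.
  assert (N1 : null_seq (fun n => E n (fun _ => 1))) by apply (HV (fun _ => 1)), cont_real_const.
  set (S := fun h => cont_real leKt h /\ null_seq (fun n => E n h)).
  assert (HS : forall f h a b, S f -> S h -> S (fun x => a * f x + b * h x)).
  { intros f h a b [Hf Nf] [Hh Nh]. split; [apply HD; assumption|].
    apply (null_seq_ext (fun n => a * E n f + b * E n h)); [|apply null_seq_lin; assumption].
    intros n. symmetry. apply HE; assumption. }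
  assert (S1 : S (fun _ => 1)) by (split; assumption).
  assert (HSs : subspace S).
  { split; [|exact HS]. split; [apply cont_real_const|]. apply (HV (fun _ => 0)), cont_real_const. }
  assert (Hd : 0 < eps / (2 * (M + 1))) by (apply Rdiv_lt_0_compat; lra).
  destruct (ramps_dense S g (eps / (2 * (M + 1))) HKt HSs S1) as (f & [Hf Nf] & Hgf);
    [|exact Hg|exact Hd|].
  - intros p q Hpq. destruct (pullback_or_cut_ramp p q Hpq) as [(r & Hr & Hrr)|[a Ha]].
    + exists (fun z => r (pr z)). split; [|exact Hrr]. split; [apply cont_pullback, Hr|apply HV, Hr].
    + exists (fun z => 1 * 1 + (-1) * cut a z). split; [|exact Ha].
      apply (HS (fun _ => 1) (cut a)); [exact S1|split; [apply cont_cut|apply Hcut]].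
  - destruct (Nf (eps / 2) ltac:(lra)) as [N HN]. exists N. intros n Hn. specialize (HN n Hn).
    assert (Hdiff : Rabs (E n (fun z => 1 * g z + (-1) * f z)) <= M * (eps / (2 * (M + 1)))).
    { apply (bounded_on_scale _ _ _ HD (HE n)); [apply HD; assumption|exact Hd|].
      intros x. replace (1 * g x + -1 * f x) with (g x - f x) by ring. apply Hgf. }
    rewrite (proj1 (HE n)) in Hdiff by assumption.
    replace (E n g) with ((1 * E n g + -1 * E n f) + E n f) by ring.
    eapply Rle_lt_trans; [apply Rabs_triang|].
    assert (M * (eps / (2 * (M + 1))) = eps / 2 - eps / (2 * (M + 1))) by (field; lra). lra.
Qed.

(* [e n] is corrected by a finite combination of jumps over the first [d n]
   exceptional points, which restores convergence at these points. *)
Lemma c0_extension : c0I_ext_property leKt leK pr nat.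
Proof.
  intros T (Tlin & [M TM] & Tc0).
  assert (HV : subspace V).
  { split; [exists (fun _ => 0); split; [apply cont_real_const|reflexivity]|].
    intros g h a b (f1 & Hf1 & E1) (f2 & Hf2 & E2). exists (fun x => a * f1 x + b * f2 x).
    split; [apply (cont_real_lin (proj1 HK)); assumption|]. intros z. rewrite E1, E2; reflexivity. }
  assert (HVb : forall g, V g -> bounded_fun g).
  { intros g (f & Hf & Eg). destruct (cont_real_bounded f (complete_line_compact HK) Hf) as [c Hc].
    exists c. intros z. rewrite Eg. apply Hc. }
  destruct (choice (fun n e => bounded_on bounded_fun e M /\ forall g, V g -> e g = T g n)) as [e He].
  { intros n. apply (hahn_banach V (fun g => T g n) M HV HVb).
    split; [intros; apply Tlin; assumption|intros; apply TM; assumption]. }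
  assert (Hpb : forall f, cont_real leK f -> V (fun z => f (pr z))) by (intros f Hf; exists f; auto).
  assert (Hnull : forall f, cont_real leK f -> null_seq (fun n => e n (fun z => f (pr z)))).
  { intros f Hf. apply (null_seq_ext (T (fun z => f (pr z)))).
    - intros n. symmetry. apply (proj2 (He n)), Hpb, Hf.
    - apply in_c0_nat, Tc0, Hpb, Hf. }
  assert (Hfall : forall a k, null_seq (fun n => e n (fun z => fall (t a) k (pr z))))
    by (intros; apply Hnull, fall_spec).
  assert (Hb : forall g, cont_real leKt g -> bounded_fun g)
    by (intros g; apply cont_real_bounded, complete_line_compact, HKt).
  assert (Hloc : forall n a k, e n (local_cut a k) =
    e n (cut a) - e n (fun z => fall (t a) k (pr z))).
  { intros n a k. unfold local_cut. rewrite (proj1 (proj1 (He n))); [ring| |].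
    - apply Hb, cont_cut.
    - apply Hb, cont_pullback, fall_spec. }
  assert (Hnode : forall a k, node_bounded a k (local_cut a k)).
  { intros a k. split; [apply local_cut_bound|apply local_cut_support]. }
  set (B := fun a => forall k, exists n v, node_bounded a (S k) v /\ e n v <> 0).
  assert (Bc : countable_set B) by (apply (charged_branches_countable e M); apply He).
  (* Outside [B] some node around [t a] is charged by no [e n]. There the bump has value 0, so the
     cut has the same values as a fall, which is a function on [K]. *)
  assert (HnB : forall a, ~ B a -> null_seq (fun n => e n (cut a))).
  { intros a Ha. apply not_all_ex_not in Ha. destruct Ha as [k Hk].
    apply (null_seq_ext (fun n => e n (fun z => fall (t a) (S k) (pr z)))); [|apply Hfall].
    intros n. assert (H0 : e n (local_cut a (S k)) = 0).
    { apply NNPP; intros H. apply Hk. exists n, (local_cut a (S k)). split; [apply Hnode|exact H]. }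
    rewrite Hloc in H0. lra. }
  destruct Bc as [code Hcode].
  (* [F k] lists the exceptional points with code below [k], and [m k] is a length at which their
     nodes are disjoint. *)
  destruct (choice (fun k l => NoDup l /\ forall a, In a l <-> B a /\ (code a < k)%nat)) as [F HF].
  { induction x as [|k (l & Hl & IH)].
    - exists nil. split; [constructor|]. intros a; split; [intros []|lia].
    - destruct (classic (exists a, B a /\ code a = k)) as [(a & Ba & Ca)|H].
      + exists (a :: l). split.
        * constructor; [|exact Hl]. intros H. apply IH in H. lia.
        * intros b; split.
          -- intros [<-|H]; [split; [exact Ba|lia]|]. apply IH in H. split; [apply H|lia].
          -- intros [Bb Cb]. destruct (Nat.eq_dec (code b) k) as [E|E].
             ++ left. apply Hcode; [assumption..|congruence].
             ++ right. apply IH. split; [exact Bb|lia].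
      + exists l. split; [exact Hl|]. intros b; split.
        * intros Hbl. apply IH in Hbl. split; [apply Hbl|lia].
        * intros [Bb Cb]. apply IH. split; [exact Bb|].
          destruct (Nat.eq_dec (code b) k) as [E|E]; [exfalso; eauto|lia]. }
  destruct (choice (fun k m => separated m (F k))) as [m Hm].
  { intros k. destruct (separation_level (F k) O (proj1 (HF k))) as (m & _ & Hm). eauto. }
  (* [d] grows so slowly that at time [n] the falls belonging to [F (d n)] are already small; at
     index 0 the list is empty. *)
  destruct (eventually_diagonal (fun k n => forall a, In a (F k) ->
    Rabs (e n (fun z => fall (t a) (m k) (pr z))) <= / INR (S k))) as (d & Hd & Hdinf).
  { intros n a Ha. apply (HF O) in Ha. lia. }
  { intros k. generalize (F k). induction l as [|a l [N IH]]; [exists O; intros n _ a []|].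
    destruct (Hfall a (m k) (/ INR (S k))) as [N' HN'].
    { apply Rinv_0_lt_compat, lt_0_INR; lia. }
    exists (max N N'). intros n Hn b [<-|Hbl].
    - left. apply HN'; lia.
    - apply IH; [lia|exact Hbl]. }
  set (c := fun n a => e n (local_cut a (m (d n)))).
  (* On the cut at a listed point the correction removes the value at the bump and leaves the value
     at the fall, which tends to zero. *)
  set (E := fun g n => e n g - sum_list (fun a => c n a * jump a g) (F (d n))).
  assert (Hc : forall n, sum_list (fun a => Rabs (c n a)) (F (d n)) <= M).
  { intros n. apply (sum_abs_le bounded_fun (e n) M subspace_bounded (proj1 (He n))).
    - intros a _. apply Hb, cont_local_cut.
    - apply (sum_node_supported (fun a => local_cut a (m (d n))) _ _ (Hm (d n)));
        intros; [apply local_cut_bound|apply local_cut_support; assumption]. }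
  assert (EV : forall f n, E (fun z => f (pr z)) n = e n (fun z => f (pr z))).
  { intros f n. unfold E. rewrite (sum_list_ext _ (fun _ => 0)), sum_list_const; [ring|].
    intros a _. rewrite jump_pullback. ring. }
  (* The constant is [M] for [e n] plus [2 * M] for the correction, a jump on the unit ball being at
     most 2. *)
  assert (Eb : forall n, bounded_on (cont_real leKt) (fun g => E g n) (3 * M)).
  { intros n. split.
    - intros g h a b Hg Hh. unfold E. rewrite (proj1 (proj1 (He n))) by (apply Hb; assumption).
      rewrite (sum_list_ext _ (fun i => a * (c n i * jump i g) + b * (c n i * jump i h)))
        by (intros; unfold jump; ring).
      rewrite sum_list_lin. ring.
    - intros g Hg Hg1. unfold E, Rminus. eapply Rle_trans; [apply Rabs_triang|].
      rewrite Rabs_Ropp. pose proof (proj2 (proj1 (He n)) g (Hb g Hg) Hg1).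
      enough (Rabs (sum_list (fun a => c n a * jump a g) (F (d n))) <= 2 * M) by lra.
      eapply Rle_trans; [apply Rabs_sum_list|].
      apply Rle_trans with (2 * sum_list (fun a => Rabs (c n a)) (F (d n))).
      + rewrite <- sum_list_scal. apply sum_list_le. intros a _. rewrite Rabs_mult, Rmult_comm.
        apply Rmult_le_compat_r; [apply Rabs_pos|].
        pose proof (jump_bound a g 1 Hg1). lra.
      + specialize (Hc n). lra. }
  exists E. split; [split; [|split]|].
  - intros g h a b Hg Hh n. apply (proj1 (Eb n)); assumption.
  - exists (3 * M). intros g Hg Hg1 n. apply (Eb n); assumption.
  - intros g Hg. apply in_c0_nat. revert g Hg.
    apply (null_on_generators (fun n g => E g n) (3 * M) Eb).
    + intros f Hf. apply (null_seq_ext (fun n => e n (fun z => f (pr z)))); [|apply Hnull, Hf].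
      intros n. symmetry; apply EV.
    + intros b. destruct (classic (B b)) as [Bb|Bb].
      * intros eps Heps. destruct (archimed_cor1 eps Heps) as (N & HN & HN0).
        (* [S (code b)] puts [b] on the list [F (d n)], and [N] makes [/ INR (S (d n))] smaller than
           [eps]. *)
        destruct (Hdinf (max N (S (code b)))) as [N' HN']. exists N'. intros n Hn.
        specialize (HN' n Hn).
        assert (Hbin : In b (F (d n))) by (apply HF; split; [exact Bb|lia]).
        unfold E. rewrite (sum_list_single _ b _ (proj1 (HF (d n))) Hbin).
        -- rewrite jump_cut_same. unfold c. rewrite Hloc.
           match goal with |- Rabs ?r < _ =>
             replace r with (e n (fun z => fall (t b) (m (d n)) (pr z))) by ring end.
           eapply Rle_lt_trans; [apply Hd, Hbin|]. eapply Rle_lt_trans; [|exact HN].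
           apply Rinv_le_contravar; [apply lt_0_INR, HN0|apply le_INR; lia].
        -- intros a Ha. rewrite jump_cut_other by exact Ha. ring.
      * apply (null_seq_ext (fun n => e n (cut b))); [|apply HnB, Bb].
        intros n. unfold E. rewrite (sum_list_ext _ (fun _ => 0)), sum_list_const; [ring|].
        intros a Ha. rewrite jump_cut_other; [ring|]. intros ->. apply HF in Ha. tauto.
  - intros g Vg n. rewrite <- (proj2 (He n) g Vg). destruct Vg as (f & Hf & Eg).
    apply functional_extensionality in Eg. subst g. apply EV.
Qed.

End SequenceExtension.
End SplitLexicographic.

Theorem theorem4p7 (L : Type) (leL : L -> L -> Prop) :
  compact_line leL -> uncountable L ->
  exists (Kt : Type) (leKt : Kt -> Kt -> Prop) (phi : Kt -> (nat -> L)),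
    compact_line leKt /\
    order_continuous leKt (lex leL) phi /\
    order_increasing leKt (lex leL) phi /\
    onto phi /\
    c0I_ext_property leKt (lex leL) phi nat /\
    exists (W : Type) (ltW : W -> W -> Prop),
      is_omega1 ltW /\ ~ c0I_ext_property leKt (lex leL) phi W.
Proof.
  intros HL Hunc.
  assert (exists x0 : L, True) as [x0 _].
  { apply NNPP; intros H. apply Hunc. exists (fun _ => O). intros x. exfalso; eauto. }
  pose proof (compact_line_complete x0 HL) as Hcl.
  destruct (complete_bottom Hcl) as [bot Hbot]. destruct (complete_top Hcl) as [top Htop].
  (* Equal ends would leave a single point; distinct ones make every node nondegenerate. *)
  assert (Hne : bot <> top).
  { intros E. apply Hunc. exists (fun _ => O). intros x y _.
    pose proof (proj1 HL) as (_ & Ha & Ht & _). subst top. transitivity bot; apply Ha; auto. }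
  destruct (omega1_embeds L Hunc) as (Z & ltZ & i & HZ & Hi).
  destruct (ladder_system ltZ HZ) as (A & j & c & Hj & Hc & Hsmall & Hbig).
  set (t := fun a k => i (c a k)).
  assert (Hagree : forall n a b, agree n (t a) (t b) <-> agree n (c a) (c b)).
  { intros n a b. split; intros H m Hm; [apply Hi, H, Hm|unfold t; rewrite (H m Hm); reflexivity]. }
  assert (Ht : forall a b, t a = t b -> a = b).
  { intros a b E. apply Hc, functional_extensionality. intros k. apply Hi.
    exact (f_equal (fun f => f k) E). }
  pose proof (lex_complete leL Hcl) as HK.
  exists (split_line (fun x => exists a, t a = x)), (split_le (lex leL) _), (proj _).
  split; [apply complete_line_compact, split_complete, HK|].
  split; [apply proj_continuous, HK|].
  split; [apply proj_increasing, HK|].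
  split; [apply proj_onto|].
  split.
  - apply (c0_extension leL Hcl bot top Hbot Htop Hne t Ht). intros S HS.
    apply Hsmall in HS. revert HS. apply countable_set_sub. intros a Ha k.
    destruct (Ha k) as (s & Ss & E). exists s; split; [exact Ss|apply Hi, E].
  - exists (Z * nat)%type, (Relation_Operators.slexprod Z nat ltZ Peano.lt).
    split; [apply omega1_times_nat, HZ|].
    destruct (Hbig (fun _ => O)) as [a0 _].
    apply (no_c0_extension leL Hcl bot top Hbot Htop Hne t Ht (inhabits a0))
      with (j := fun p => (j (fst p), snd p)).
    + intros n. destruct (Hbig n) as [a Ha]. exists a. intros H. apply Ha. revert H.
      apply countable_set_sub. intros b [H1 H2]. split; [exact H1|apply Hagree, H2].
    + intros [a m] [b n] E. injection E as E1 E2. apply Hj in E1. simpl in *. congruence.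
Qed.
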